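(* Every aperiodic $C^*$-inclusion $A\subseteq B$ has the generalised intersection property. The hidden ideal is the largest (closed, two-sided) ideal of $B$ that is aperiodic as an $A$-bimodule.
   Context: All ideals are closed and two-sided. A $C^*$-inclusion $A\subseteq B$ is a $C^*$-algebra $B$ with a $C^*$-subalgebra $A$. A normed $A$-bimodule $X$ is aperiodic if for every $x\in X$, every non-zero hereditary $C^*$-subalgebra $D\subseteq A$ and every $\varepsilon>0$ there is $a\in D$ with $a\ge0$, $\|a\|=1$ and $\|axa\|<\varepsilon$. The inclusion $A\subseteq B$ is aperiodic if the Banach $A$-bimodule $B/A$ with the quotient norm is aperiodic. The inclusion $A\subseteq B$ has the generalised intersection property if there is a unique maximal element among the ideals $J$ of $B$ with $J\cap A=0$; this maximal element is called the hidden ideal. (Equivalently, there is an ideal $\mathcal{N}$ of $B$ such that for all ideals $J$ of $B$: $J\cap A=0$ if and only if $J\subseteq\mathcal{N}$.) *)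

(* Defs.v *)
From HB Require Import structures.
From mathcomp Require Import all_boot all_order all_algebra.
From mathcomp Require Import ring_quotient complex.
From mathcomp Require Import boolp classical_sets reals topology normedtype.

Set Implicit Arguments.
Unset Strict Implicit.
Unset Printing Implicit Defensive.

Import Order.TTheory GRing.Theory Num.Theory.
Import numFieldNormedType.Exports.

Local Open Scope classical_set_scope.
Local Open Scope ring_scope.
Local Open Scope complex_scope.

(* C*-algebras are not assumed to be unital, so the MathComp ring structures
   do not apply and the product is a field of the mixin.  As everywhere in
   MathComp-Analysis, the norm of a normed module over [R[i]] takes its values
   in [R[i]]; its values are nonnegative reals. *)
HB.mixin Record NormedModule_isCStarAlgebra (R : realType) B
    of NormedModule R[i] B := {
  cmul : B -> B -> B;
  adj : B -> B;
  cmulA : associative cmul;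
  cmulDl : left_distributive cmul +%R;
  cmulDr : right_distributive cmul +%R;
  cscaleAl : forall (k : R[i]) (x y : B), k *: cmul x y = cmul (k *: x) y;
  cscaleAr : forall (k : R[i]) (x y : B), k *: cmul x y = cmul x (k *: y);
  ler_norm_cmul : forall x y : B, `|cmul x y| <= `|x| * `|y|;
  adjK : involutive adj;
  adjD : {morph adj : x y / x + y};
  adjZ : forall (k : R[i]) (x : B), adj (k *: x) = conjc k *: adj x;
  adjM : forall x y : B, adj (cmul x y) = cmul (adj y) (adj x);
  norm_adj_mul : forall x : B, `|cmul (adj x) x| = `|x| ^+ 2
}.

#[short(type="cstarAlgType")]
HB.structure Definition CStarAlgebra (R : realType) :=
  {B of CompleteNormedModule R[i] B & NormedModule_isCStarAlgebra R B}.

Declare Scope cstar_scope.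
Delimit Scope cstar_scope with CS.
Local Open Scope cstar_scope.
Notation "x ** y" := (cmul x y)
  (at level 40, left associativity) : cstar_scope.

Section RealNorm.
Variable R : realType.

Lemma real_complexD (r t : R) : (r + t)%:C = r%:C + t%:C :> R[i].
Proof. exact: (rmorphD (real_complex R)). Qed.

Lemma real_complexM (r t : R) : (r * t)%:C = r%:C * t%:C :> R[i].
Proof. exact: (rmorphM (real_complex R)). Qed.

Lemma Re_normC (k : R[i]) : (complex.Re `|k|)%:C = `|k|.
Proof. by apply: RRe_real; exact: normr_real. Qed.

Variable V : normedModType R[i].

Definition rnorm (x : V) : R := complex.Re `|x|.

Lemma rnormE (x : V) : (rnorm x)%:C = `|x|.
Proof. by apply: RRe_real; exact: normr_real. Qed.

Lemma rnorm_ge0 (x : V) : 0 <= rnorm x.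
Proof. by rewrite -lecR rnormE; exact: normr_ge0. Qed.

Lemma rnorm0 : rnorm 0 = 0.
Proof. by rewrite /rnorm normr0. Qed.

Lemma rnormD (x y : V) : rnorm (x + y) <= rnorm x + rnorm y.
Proof.
by rewrite -lecR real_complexD !rnormE; exact: Num.Theory.ler_normD.
Qed.

Lemma rnormZ (k : R[i]) (x : V) : rnorm (k *: x) = complex.Re `|k| * rnorm x.
Proof.
apply: (@complexI R).
by rewrite real_complexM !rnormE Re_normC normrZ.
Qed.

End RealNorm.

Record closedSubspace (R : realType) (V : normedModType R[i]) := ClosedSubspace {
  csub_set :> V -> Prop;
  csub0 : csub_set 0;
  csubD : forall x y : V, csub_set x -> csub_set y -> csub_set (x + y);
  csubZ : forall (k : R[i]) (x : V), csub_set x -> csub_set (k *: x);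
  csub_closed : closed (csub_set : set V)
}.

Arguments csub_closed {R V} _.

Definition csub_pred (R : realType) (V : normedModType R[i])
  (S : closedSubspace V) : pred V := fun x => x \in (csub_set S : set V).

Lemma csub_predP (R : realType) (V : normedModType R[i])
  (S : closedSubspace V) (x : V) : csub_pred S x <-> S x.
Proof. by split=> [/set_mem|/mem_set]. Qed.

Lemma csub_submod (R : realType) (V : normedModType R[i])
  (S : closedSubspace V) : submod_closed (csub_pred S).
Proof.
split; first by apply/csub_predP; exact: csub0.
move=> k x y /csub_predP Sx /csub_predP Sy; apply/csub_predP.
by apply: csubD => //; exact: csubZ.
Qed.

HB.instance Definition _ (R : realType) (V : normedModType R[i])
  (S : closedSubspace V) :=
  GRing.isSubmodClosed.Build R[i] V (csub_pred S) (csub_submod S).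

Definition csub_type (R : realType) (V : normedModType R[i])
  (S : closedSubspace V) : Type := {x : V | csub_pred S x}.

Section ClosedSubspaceType.
Variables (R : realType) (V : normedModType R[i]) (S : closedSubspace V).

HB.instance Definition _ := SubType.on (csub_type S).
HB.instance Definition _ := Choice.on (csub_type S).
HB.instance Definition _ := [SubChoice_isSubLmodule of csub_type S by <:].

Lemma csubP (u : csub_type S) : S (val u).
Proof. by apply/csub_predP; exact: valP u. Qed.

Definition csub_in (x : V) (Sx : S x) : csub_type S :=
  Sub x ((csub_predP S x).2 Sx).

Lemma val_csub_in (x : V) (Sx : S x) : val (csub_in Sx) = x.
Proof. exact: SubK. Qed.

Lemma csub_valD (u v : csub_type S) : val (u + v) = val u + val v.
Proof. exact: raddfD. Qed.

Lemma csub_valZ (k : R[i]) (u : csub_type S) : val (k *: u) = k *: val u.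
Proof. exact: linearZ. Qed.

Lemma csub_valB (u v : csub_type S) : val (u - v) = val u - val v.
Proof. exact: raddfB. Qed.

Definition csub_norm (u : csub_type S) : R[i] := `|val u|.

Lemma csub_normD u v : csub_norm (u + v) <= csub_norm u + csub_norm v.
Proof. by rewrite /csub_norm raddfD; exact: Num.Theory.ler_normD. Qed.

Lemma csub_normZ (k : R[i]) u : csub_norm (k *: u) = `|k| * csub_norm u.
Proof. by rewrite /csub_norm linearZ; exact: normrZ. Qed.

Lemma csub_norm_eq0 u : csub_norm u = 0 -> u = 0.
Proof.
by move=> /eqP; rewrite normr_eq0 => /eqP u0; apply: val_inj; rewrite u0 raddf0.
Qed.

HB.instance Definition _ := Lmodule_isNormed.Build R[i] (csub_type S)
  csub_normD csub_normZ csub_norm_eq0.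

Lemma norm_val (u : csub_type S) : `|val u| = `|u|.
Proof. by []. Qed.

End ClosedSubspaceType.

Section ClosedSubspaceComplete.
Variables (R : realType) (V : completeNormedModType R[i]).
Variable S : closedSubspace V.

Lemma csub_complete (F : set_system (csub_type S)) :
  ProperFilter F -> cauchy F -> cvg F.
Proof.
move=> FF /cauchy_ballP Fc.
have /cauchy_cvg : cauchy ((val : csub_type S -> V) @ F).
  apply/cauchy_ballP => e e0; have := Fc e e0; rewrite !near_simpl/= => Fe.
  rewrite near_map2 /=; apply: filterS Fe => -[u v] /=.
  by rewrite -!ball_normE /ball_ /= -csub_valB norm_val.
move=> /cvg_ex [l Fl].
have Sl : S l.
  have FS : \near F, S (val F) by near=> u; exact: csubP.
  exact: (@closed_cvg _ V F FF val S (csub_closed S) FS l Fl).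
apply/cvg_ex; exists (csub_in Sl); apply/cvgrPdist_lt => e e0.
move/cvgrPdist_lt : Fl => /(_ e e0); apply: filterS => u.
by rewrite -norm_val csub_valB val_csub_in.
Unshelve. all: by end_near. Qed.

HB.instance Definition _ :=
  Uniform_isComplete.Build (csub_type S) csub_complete.

End ClosedSubspaceComplete.

Definition csub_quot (R : realType) (V : normedModType R[i])
  (S : closedSubspace V) : Type :=
  Quotient.quot (GRing.ZmodClosed.clone V (csub_pred S) _).

Section ClosedSubspaceQuotient.
Local Open Scope quotient_scope.
Variables (R : realType) (V : normedModType R[i]) (S : closedSubspace V).
Local Notation Q := (csub_quot S).

HB.instance Definition _ := Choice.on Q.
HB.instance Definition _ := EqQuotient.on Q.
HB.instance Definition _ := GRing.Zmodule.on Q.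

Definition csub_pi (x : V) : Q := \pi_(csub_quot S) x.

Definition csub_repr (q : Q) : V := repr q.

Lemma csub_reprK q : csub_pi (csub_repr q) = q.
Proof. exact: reprK. Qed.

Lemma csub_piP x y : csub_pi x = csub_pi y <-> S (x - y).
Proof.
rewrite -csub_predP -[csub_pred S _]/((x - y) \in csub_pred S).
by rewrite Quotient.idealrBE; split=> [/eqP|/eqP].
Qed.

Lemma csub_piD x y : csub_pi (x + y) = csub_pi x + csub_pi y.
Proof. exact: raddfD. Qed.

Lemma csub_pi0 : csub_pi 0 = 0.
Proof. exact: raddf0. Qed.

Definition quot_scale (k : R[i]) (q : Q) : Q := csub_pi (k *: csub_repr q).

Lemma quot_scale_pi k x : quot_scale k (csub_pi x) = csub_pi (k *: x).
Proof.
apply/csub_piP; rewrite -scalerBr; apply: csubZ.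
by apply/csub_piP; rewrite csub_reprK.
Qed.

Lemma quot_scaleA k l q : quot_scale k (quot_scale l q) = quot_scale (k * l) q.
Proof. by rewrite -[q]csub_reprK !quot_scale_pi scalerA. Qed.

Lemma quot_scale1 : left_id 1 quot_scale.
Proof. by move=> q; rewrite -[q]csub_reprK quot_scale_pi scale1r. Qed.

Lemma quot_scaleDr : right_distributive quot_scale +%R.
Proof.
move=> k p q; rewrite -[p]csub_reprK -[q]csub_reprK.
by rewrite -csub_piD !quot_scale_pi scalerDr csub_piD.
Qed.

Lemma quot_scaleDl q : {morph quot_scale^~ q : k l / k + l}.
Proof.
by move=> k l; rewrite -[q]csub_reprK !quot_scale_pi scalerDl csub_piD.
Qed.

HB.instance Definition _ := GRing.Zmodule_isLmodule.Build R[i] Q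
  quot_scaleA quot_scale1 quot_scaleDr quot_scaleDl.

Lemma csub_piZ k x : csub_pi (k *: x) = k *: csub_pi x.
Proof. by rewrite -quot_scale_pi. Qed.

(* The representatives of the class of b are the b + a with a in S, so this is
   the infimum of the norms of the b + a. *)
Definition quot_rnorm (q : Q) : R :=
  inf [set rnorm x | x in [set x : V | csub_pi x = q]].

Definition quot_norm (q : Q) : R[i] := (quot_rnorm q)%:C.

Lemma quot_has_inf q : has_inf [set rnorm x | x in [set x : V | csub_pi x = q]].
Proof.
split; first by exists (rnorm (csub_repr q)), (csub_repr q) => //;
  exact: csub_reprK.
by exists 0 => _ [x _ <-]; exact: rnorm_ge0.
Qed.

Lemma quot_rnorm_le x : quot_rnorm (csub_pi x) <= rnorm x.
Proof. by apply: ge_inf; [exact: (quot_has_inf _).2|exists x]. Qed.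

Lemma le_quot_rnorm r q :
  (forall x, csub_pi x = q -> r <= rnorm x) -> r <= quot_rnorm q.
Proof.
move=> h; apply: lb_le_inf; first exact: (quot_has_inf _).1.
by move=> _ [x xq <-]; exact: h.
Qed.

Lemma quot_rnormD p q : quot_rnorm (p + q) <= quot_rnorm p + quot_rnorm q.
Proof.
rewrite -lerBlDr; apply: le_quot_rnorm => x xp.
rewrite lerBlDr -lerBlDl; apply: le_quot_rnorm => y yq.
rewrite lerBlDl -xp -yq -csub_piD.
exact: le_trans (quot_rnorm_le _) (rnormD _ _).
Qed.

Lemma quot_rnorm_bound (r : R) (p q : Q) : 0 <= r ->
  (forall x, csub_pi x = q -> quot_rnorm p <= r * rnorm x) ->
  quot_rnorm p <= r * quot_rnorm q.
Proof.
rewrite le_eqVlt => /predU1P[<-|r0] h.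
  by have := h _ (csub_reprK q); rewrite !mul0r.
by rewrite -ler_pdivrMl//; apply: le_quot_rnorm => x /h; rewrite ler_pdivrMl.
Qed.

Lemma quot_rnormZ_le (k : R[i]) q :
  quot_rnorm (k *: q) <= complex.Re `|k| * quot_rnorm q.
Proof.
apply: quot_rnorm_bound => [|x <-]; first by rewrite -lecR Re_normC normr_ge0.
by rewrite -rnormZ -csub_piZ; exact: quot_rnorm_le.
Qed.

Lemma quot_rnormZ (k : R[i]) q :
  quot_rnorm (k *: q) = complex.Re `|k| * quot_rnorm q.
Proof.
apply/eqP; rewrite eq_le quot_rnormZ_le andTb.
have [->|k0] := eqVneq k 0.
  by rewrite normr0 mul0r; apply: le_quot_rnorm => x _; exact: rnorm_ge0.
have nk0 : 0 < complex.Re `|k| by rewrite -ltcR Re_normC normr_gt0.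
rewrite mulrC -ler_pdivlMr// mulrC.
have := quot_rnormZ_le k^-1 (k *: q).
rewrite scalerA mulVf// scale1r; congr (_ <= _ * _).
apply: (@complexI R); rewrite fmorphV Re_normC normfV.
by congr (_^-1); exact: esym (Re_normC k).
Qed.

Lemma quot_normD p q : quot_norm (p + q) <= quot_norm p + quot_norm q.
Proof.
rewrite /quot_norm -real_complexD lecR; exact: quot_rnormD.
Qed.

Lemma quot_normZ (k : R[i]) q : quot_norm (k *: q) = `|k| * quot_norm q.
Proof.
by rewrite /quot_norm quot_rnormZ real_complexM Re_normC.
Qed.

Lemma quot_norm_eq0 q : quot_norm q = 0 -> q = 0.
Proof.
move=> /(congr1 (@complex.Re R)) q0.
rewrite -[q]csub_reprK -csub_pi0; apply/csub_piP; rewrite subr0.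
apply: csub_closed => U /nbhs_ballP [e e0 eU].
have re0 : 0 < complex.Re e by rewrite -ltcR RRe_real ?gtr0_real.
have [_ [y yq <-]] := inf_adherent re0 (quot_has_inf q).
rewrite [inf _]q0 add0r => ye.
exists (csub_repr q - y); split; first by apply/csub_piP; rewrite csub_reprK yq.
apply: eU; rewrite -ball_normE /ball_ /= opprB addrC subrK.
by rewrite -rnormE -(RRe_real (gtr0_real e0)) ltcR.
Qed.

HB.instance Definition _ := Lmodule_isNormed.Build R[i] Q
  quot_normD quot_normZ quot_norm_eq0.

Lemma norm_csub_quot (q : Q) : `|q| = (quot_rnorm q)%:C.
Proof. by []. Qed.

End ClosedSubspaceQuotient.

Section CStarTheory.
Variables (R : realType) (B : cstarAlgType R).

Record cstarSubalg := CStarSubalg {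
  csa_sub :> closedSubspace B;
  csa_mul : forall x y : B, csa_sub x -> csa_sub y -> csa_sub (x ** y);
  csa_adj : forall x : B, csa_sub x -> csa_sub (adj x)
}.

Record closedIdeal := ClosedIdeal {
  cid_sub :> closedSubspace B;
  cid_mulr : forall b x : B, cid_sub x -> cid_sub (b ** x);
  cid_mull : forall x b : B, cid_sub x -> cid_sub (x ** b)
}.

Lemma closedIdeal_eq (I J : closedIdeal) : (I : set B) = (J : set B) -> I = J.
Proof.
case: I J => -[I I0 ID IZ Ic] Il Ir [[J J0 JD JZ Jc] Jl Jr] /= IJ.
case: J / IJ J0 JD JZ Jc Jl Jr => J0 JD JZ Jc Jl Jr.
rewrite (Prop_irrelevance J0 I0) (Prop_irrelevance JD ID) in Jl Jr *.
rewrite (Prop_irrelevance JZ IZ) (Prop_irrelevance Jc Ic) in Jl Jr *.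
by rewrite (Prop_irrelevance Jl Il) (Prop_irrelevance Jr Ir).
Qed.

(* The elements adj b ** b are exactly the self-adjoint elements with
   nonnegative spectrum; this form also makes sense without a unit. *)
Definition cpos (a : B) : Prop := exists b : B, a = adj b ** b.

Definition cle (a b : B) : Prop := cpos (b - a).

Definition hereditary (D : cstarSubalg) : Prop :=
  forall a d : B, cpos a -> cle a d -> D d -> D a.

Definition nonzero_subalg (D : cstarSubalg) : Prop :=
  exists2 d : B, D d & d != 0.

Lemma cmul_subl (x y z : B) : (x - y) ** z = x ** z - y ** z.
Proof. by rewrite cmulDl -scaleN1r -cscaleAl scaleN1r. Qed.

Lemma cmul_subr (x y z : B) : z ** (x - y) = z ** x - z ** y.
Proof. by rewrite cmulDr -[- y]scaleN1r -cscaleAr scaleN1r. Qed.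

Lemma rnorm_cmul (x y : B) : rnorm (x ** y) <= rnorm x * rnorm y.
Proof. by rewrite -lecR real_complexM !rnormE; exact: ler_norm_cmul. Qed.

End CStarTheory.

Definition csa_type (R : realType) (B : cstarAlgType R) (A : cstarSubalg B) :
  Type := csub_type A.

Section SubalgebraType.
Variables (R : realType) (B : cstarAlgType R) (A : cstarSubalg B).
Local Notation T := (csa_type A).

HB.instance Definition _ := CompleteNormedModule.on T.

Definition csa_val (a : T) : B := \val (a : csub_type A).

Definition csa_tmul (x y : T) : T := csub_in (csa_mul (csubP x) (csubP y)).

Definition csa_tadj (x : T) : T := csub_in (csa_adj (csubP x)).

Lemma csa_val_inj : injective csa_val.
Proof. exact: val_inj. Qed.

Lemma csa_valD x y : csa_val (x + y) = csa_val x + csa_val y.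
Proof. exact: csub_valD. Qed.

Lemma csa_valZ (k : R[i]) x : csa_val (k *: x) = k *: csa_val x.
Proof. exact: csub_valZ. Qed.

Lemma csa_val_tmul x y : csa_val (csa_tmul x y) = csa_val x ** csa_val y.
Proof. exact: val_csub_in. Qed.

Lemma csa_val_tadj x : csa_val (csa_tadj x) = adj (csa_val x).
Proof. exact: val_csub_in. Qed.

Let csa_valE := (csa_valD, csa_valZ, csa_val_tmul, csa_val_tadj).

Lemma norm_csa_val (x : T) : `|csa_val x| = `|x|.
Proof. by []. Qed.

Fact csa_tmulA : associative csa_tmul.
Proof. by move=> x y z; apply: csa_val_inj; rewrite !csa_valE cmulA. Qed.

Fact csa_tmulDl : left_distributive csa_tmul +%R.
Proof. by move=> x y z; apply: csa_val_inj; rewrite !csa_valE cmulDl. Qed.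

Fact csa_tmulDr : right_distributive csa_tmul +%R.
Proof. by move=> x y z; apply: csa_val_inj; rewrite !csa_valE cmulDr. Qed.

Fact csa_tscaleAl (k : R[i]) x y : k *: csa_tmul x y = csa_tmul (k *: x) y.
Proof. by apply: csa_val_inj; rewrite !csa_valE cscaleAl. Qed.

Fact csa_tscaleAr (k : R[i]) x y : k *: csa_tmul x y = csa_tmul x (k *: y).
Proof. by apply: csa_val_inj; rewrite !csa_valE cscaleAr. Qed.

Fact csa_norm_tmul x y : `|csa_tmul x y| <= `|x| * `|y|.
Proof. by rewrite -!norm_csa_val csa_val_tmul; exact: ler_norm_cmul. Qed.

Fact csa_tadjK : involutive csa_tadj.
Proof. by move=> x; apply: csa_val_inj; rewrite !csa_valE adjK. Qed.

Fact csa_tadjD : {morph csa_tadj : x y / x + y}.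
Proof. by move=> x y; apply: csa_val_inj; rewrite !csa_valE adjD. Qed.

Fact csa_tadjZ (k : R[i]) x : csa_tadj (k *: x) = conjc k *: csa_tadj x.
Proof. by apply: csa_val_inj; rewrite !csa_valE adjZ. Qed.

Fact csa_tadjM x y : csa_tadj (csa_tmul x y) = csa_tmul (csa_tadj y) (csa_tadj x).
Proof. by apply: csa_val_inj; rewrite !csa_valE adjM. Qed.

Fact csa_norm_adj_mul x : `|csa_tmul (csa_tadj x) x| = `|x| ^+ 2.
Proof. by rewrite -!norm_csa_val !csa_valE; exact: norm_adj_mul. Qed.

HB.instance Definition _ := NormedModule_isCStarAlgebra.Build R T
  csa_tmulA csa_tmulDl csa_tmulDr csa_tscaleAl csa_tscaleAr csa_norm_tmul
  csa_tadjK csa_tadjD csa_tadjZ csa_tadjM csa_norm_adj_mul.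

Lemma csa_valM (x y : T) : csa_val (x ** y) = csa_val x ** csa_val y.
Proof. exact: csa_val_tmul. Qed.

Lemma csa_val_adj (x : T) : csa_val (adj x) = adj (csa_val x).
Proof. exact: csa_val_tadj. Qed.

Lemma csa_valP (x : T) : A (csa_val x).
Proof. exact: csubP. Qed.

End SubalgebraType.

Record normedBimod (R : realType) (A : cstarAlgType R) := NormedBimod {
  bimod_sort :> normedModType R[i];
  lact : A -> bimod_sort -> bimod_sort;
  ract : bimod_sort -> A -> bimod_sort;
  lactDl : forall a b x, lact (a + b) x = lact a x + lact b x;
  lactDr : forall a x y, lact a (x + y) = lact a x + lact a y;
  lactZl : forall (k : R[i]) a x, lact (k *: a) x = k *: lact a x;
  lactZr : forall (k : R[i]) a x, lact a (k *: x) = k *: lact a x;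
  ractDl : forall x y a, ract (x + y) a = ract x a + ract y a;
  ractDr : forall x a b, ract x (a + b) = ract x a + ract x b;
  ractZl : forall (k : R[i]) x a, ract (k *: x) a = k *: ract x a;
  ractZr : forall (k : R[i]) x a, ract x (k *: a) = k *: ract x a;
  lactA : forall a b x, lact (a ** b) x = lact a (lact b x);
  ractA : forall x a b, ract x (a ** b) = ract (ract x a) b;
  lractA : forall a x b, ract (lact a x) b = lact a (ract x b);
  norm_lact : forall a x, `|lact a x| <= `|a| * `|x|;
  norm_ract : forall x a, `|ract x a| <= `|x| * `|a|
}.

Definition aperiodic (R : realType) (A : cstarAlgType R) (X : normedBimod A) :
    Prop :=
  forall (x : X) (D : cstarSubalg A), hereditary D -> nonzero_subalg D ->
  forall eps : R, 0 < eps ->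
  exists a : A, [/\ D a, cpos a, `|a| = 1 & `|ract (lact a x) a| < eps%:C].

Section IdealBimodule.
Variables (R : realType) (B : cstarAlgType R) (A : cstarSubalg B).
Variable J : closedIdeal B.
Local Notation X := (csub_type J).
Local Notation T := (csa_type A).

Definition ideal_lact (a : T) (x : X) : X :=
  csub_in (cid_mulr (csa_val a) (csubP x)).

Definition ideal_ract (x : X) (a : T) : X :=
  csub_in (cid_mull (csa_val a) (csubP x)).

Lemma val_ideal_lact a x : val (ideal_lact a x) = csa_val a ** val x.
Proof. exact: val_csub_in. Qed.

Lemma val_ideal_ract x a : val (ideal_ract x a) = val x ** csa_val a.
Proof. exact: val_csub_in. Qed.

Let valE := (val_ideal_lact, val_ideal_ract, @csub_valD, @csub_valZ,
  @csa_valD, @csa_valZ, @csa_valM).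

Fact ideal_lactDl a b x : ideal_lact (a + b) x = ideal_lact a x + ideal_lact b x.
Proof. by apply: val_inj; rewrite !valE cmulDl. Qed.

Fact ideal_lactDr a x y : ideal_lact a (x + y) = ideal_lact a x + ideal_lact a y.
Proof. by apply: val_inj; rewrite !valE cmulDr. Qed.

Fact ideal_lactZl (k : R[i]) a x : ideal_lact (k *: a) x = k *: ideal_lact a x.
Proof. by apply: val_inj; rewrite !valE cscaleAl. Qed.

Fact ideal_lactZr (k : R[i]) a x : ideal_lact a (k *: x) = k *: ideal_lact a x.
Proof. by apply: val_inj; rewrite !valE cscaleAr. Qed.

Fact ideal_ractDl x y a : ideal_ract (x + y) a = ideal_ract x a + ideal_ract y a.
Proof. by apply: val_inj; rewrite !valE cmulDl. Qed.

Fact ideal_ractDr x a b : ideal_ract x (a + b) = ideal_ract x a + ideal_ract x b.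
Proof. by apply: val_inj; rewrite !valE cmulDr. Qed.

Fact ideal_ractZl (k : R[i]) x a : ideal_ract (k *: x) a = k *: ideal_ract x a.
Proof. by apply: val_inj; rewrite !valE cscaleAl. Qed.

Fact ideal_ractZr (k : R[i]) x a : ideal_ract x (k *: a) = k *: ideal_ract x a.
Proof. by apply: val_inj; rewrite !valE cscaleAr. Qed.

Fact ideal_lactA a b x : ideal_lact (a ** b) x = ideal_lact a (ideal_lact b x).
Proof. by apply: val_inj; rewrite !valE cmulA. Qed.

Fact ideal_ractA x a b : ideal_ract x (a ** b) = ideal_ract (ideal_ract x a) b.
Proof. by apply: val_inj; rewrite !valE cmulA. Qed.

Fact ideal_lractA a x b :
  ideal_ract (ideal_lact a x) b = ideal_lact a (ideal_ract x b).
Proof. by apply: val_inj; rewrite !valE cmulA. Qed.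

Fact ideal_norm_lact a x : `|ideal_lact a x| <= `|a| * `|x|.
Proof.
by rewrite -!norm_val val_ideal_lact; exact: ler_norm_cmul.
Qed.

Fact ideal_norm_ract x a : `|ideal_ract x a| <= `|x| * `|a|.
Proof.
by rewrite -!norm_val val_ideal_ract; exact: ler_norm_cmul.
Qed.

Definition ideal_bimod : normedBimod (csa_type A) :=
  NormedBimod ideal_lactDl ideal_lactDr ideal_lactZl ideal_lactZr
    ideal_ractDl ideal_ractDr ideal_ractZl ideal_ractZr
    ideal_lactA ideal_ractA ideal_lractA ideal_norm_lact ideal_norm_ract.

End IdealBimodule.

Section QuotientBimodule.
Variables (R : realType) (B : cstarAlgType R) (A : cstarSubalg B).
Local Notation X := (csub_quot A).
Local Notation T := (csa_type A).

Definition quot_lact (a : T) (x : X) : X :=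
  csub_pi A (csa_val a ** csub_repr x).

Definition quot_ract (x : X) (a : T) : X :=
  csub_pi A (csub_repr x ** csa_val a).

Lemma quot_lact_pi a b : quot_lact a (csub_pi A b) = csub_pi A (csa_val a ** b).
Proof.
apply/csub_piP; rewrite -cmul_subr; apply: csa_mul; first exact: csa_valP.
by apply/csub_piP; rewrite csub_reprK.
Qed.

Lemma quot_ract_pi a b : quot_ract (csub_pi A b) a = csub_pi A (b ** csa_val a).
Proof.
apply/csub_piP; rewrite -cmul_subl; apply: csa_mul; last exact: csa_valP.
by apply/csub_piP; rewrite csub_reprK.
Qed.

Let piE := (quot_lact_pi, quot_ract_pi, @csa_valD, @csa_valZ, @csa_valM).

Fact quot_lactDl a b x : quot_lact (a + b) x = quot_lact a x + quot_lact b x.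
Proof. by rewrite -[x]csub_reprK !piE cmulDl csub_piD. Qed.

Fact quot_lactDr a x y : quot_lact a (x + y) = quot_lact a x + quot_lact a y.
Proof.
by rewrite -[x]csub_reprK -[y]csub_reprK -csub_piD !piE cmulDr csub_piD.
Qed.

Fact quot_lactZl (k : R[i]) a x : quot_lact (k *: a) x = k *: quot_lact a x.
Proof. by rewrite -[x]csub_reprK !piE -cscaleAl csub_piZ. Qed.

Fact quot_lactZr (k : R[i]) a x : quot_lact a (k *: x) = k *: quot_lact a x.
Proof. by rewrite -[x]csub_reprK -csub_piZ !piE -cscaleAr csub_piZ. Qed.

Fact quot_ractDl x y a : quot_ract (x + y) a = quot_ract x a + quot_ract y a.
Proof.
by rewrite -[x]csub_reprK -[y]csub_reprK -csub_piD !piE cmulDl csub_piD.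
Qed.

Fact quot_ractDr x a b : quot_ract x (a + b) = quot_ract x a + quot_ract x b.
Proof. by rewrite -[x]csub_reprK !piE cmulDr csub_piD. Qed.

Fact quot_ractZl (k : R[i]) x a : quot_ract (k *: x) a = k *: quot_ract x a.
Proof. by rewrite -[x]csub_reprK -csub_piZ !piE -cscaleAl csub_piZ. Qed.

Fact quot_ractZr (k : R[i]) x a : quot_ract x (k *: a) = k *: quot_ract x a.
Proof. by rewrite -[x]csub_reprK !piE -cscaleAr csub_piZ. Qed.

Fact quot_lactA a b x : quot_lact (a ** b) x = quot_lact a (quot_lact b x).
Proof. by rewrite -[x]csub_reprK !piE cmulA. Qed.

Fact quot_ractA x a b : quot_ract x (a ** b) = quot_ract (quot_ract x a) b.
Proof. by rewrite -[x]csub_reprK !piE cmulA. Qed.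

Fact quot_lractA a x b : quot_ract (quot_lact a x) b = quot_lact a (quot_ract x b).
Proof. by rewrite -[x]csub_reprK !piE cmulA. Qed.

Fact quot_norm_lact a x : `|quot_lact a x| <= `|a| * `|x|.
Proof.
rewrite !norm_csub_quot -(norm_csa_val a) -rnormE -real_complexM lecR.
apply: quot_rnorm_bound => [|b <-]; first exact: rnorm_ge0.
by rewrite quot_lact_pi; exact: le_trans (quot_rnorm_le _ _) (rnorm_cmul _ _).
Qed.

Fact quot_norm_ract x a : `|quot_ract x a| <= `|x| * `|a|.
Proof.
rewrite !norm_csub_quot -(norm_csa_val a) -rnormE -real_complexM lecR mulrC.
apply: quot_rnorm_bound => [|b <-]; first exact: rnorm_ge0.
rewrite quot_ract_pi mulrC.
exact: le_trans (quot_rnorm_le _ _) (rnorm_cmul _ _).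
Qed.

Definition quot_bimod : normedBimod (csa_type A) :=
  NormedBimod quot_lactDl quot_lactDr quot_lactZl quot_lactZr
    quot_ractDl quot_ractDr quot_ractZl quot_ractZr
    quot_lactA quot_ractA quot_lractA quot_norm_lact quot_norm_ract.

End QuotientBimodule.

Section Inclusions.
Variables (R : realType) (B : cstarAlgType R) (A : cstarSubalg B).

Definition aperiodic_inclusion : Prop := aperiodic (quot_bimod A).

Definition trivial_meet (J : closedIdeal B) : Prop :=
  (J : set B) `&` (A : set B) = [set 0].

Definition maximal_trivial_meet (N : closedIdeal B) : Prop :=
  trivial_meet N /\
  forall J : closedIdeal B, trivial_meet J ->
    (N : set B) `<=` (J : set B) -> (J : set B) `<=` (N : set B).

Definition generalised_intersection_property : Prop :=
  exists! N : closedIdeal B, maximal_trivial_meet N.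

Definition hidden_ideal (N : closedIdeal B) : Prop :=
  unique maximal_trivial_meet N.

Definition largest_aperiodic_ideal (N : closedIdeal B) : Prop :=
  aperiodic (ideal_bimod A N) /\
  forall J : closedIdeal B, aperiodic (ideal_bimod A J) ->
    (J : set B) `<=` (N : set B).

End Inclusions.

(* Main.v *)
From HB Require Import structures.
Require Import Defs.
From mathcomp Require Import all_boot all_order all_algebra.
From mathcomp Require Import complex reals.
From mathcomp Require Import boolp classical_sets topology normedtype.
From mathcomp Require Import ring lra.

(** Say that x in B is small on hereditary subalgebras when every nonzero
    hereditary subalgebra D of A contains positive norm-one elements a with
    a x a of arbitrarily small norm; an ideal of B is aperiodic exactly when
    all its elements have this property ([kishimoto] below).  The proof
    exhibits one ideal that is at the same time the largest aperiodic ideal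
    and the largest ideal meeting A trivially, namely the largest ideal
    [aperiodic_core] consisting of such elements.

    The set of these x is a closed subspace.  The point is additivity: once
    a x a is small for some positive a in D of norm one, one looks for the
    element taking care of y inside a hereditary subalgebra of D on which a
    acts almost as a unit ([local_unit]), and it then still takes care of x.
    Consequently the x such that u x v lies in this subspace for all u and v
    form a closed ideal, and it contains every aperiodic ideal.

    An ideal made of such elements meets A trivially: if it contained a
    positive a of norm one in A, then d a d would stay within 1/2 of d d, of
    norm one, for all norm-one positive d in a hereditary subalgebra on which
    a is nearly a unit ([trivial_meet_of_kishimoto]).

    Conversely, let J meet A trivially.  Then A embeds isometrically in B/J,
    so that |a| <= |a + j| for a in A and j in J ([rnorm_le_add_ideal]), and
    therefore |j| is at most twice the distance from j to A.  So J embeds in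
    B/A with an equivalent norm, and inherits aperiodicity from it
    ([kishimoto_of_trivial_meet]).

    Since B need not have a unit, all of this rests on positivity in the
    unitization of a C*-algebra, which is developed without spectra:
    positivity of a selfadjoint a is read off the inequality |t - a| <= t,
    which produces a square root by an iteration dominated by a real one,
    and every star b * b is then shown to be positive by the argument of
    Kelley and Vaught ([upos_star_mul]).  The only spectral constructions
    that occur are the parts |x| + x and |x| - x of x = a - t, whose product
    vanishes; they replace continuous functions supported above and below
    the level t. *)

Set Implicit Arguments.
Unset Strict Implicit.
Unset Printing Implicit Defensive.

Import Order.TTheory GRing.Theory Num.Theory.
Import numFieldNormedType.Exports.

Local Open Scope classical_set_scope.
Local Open Scope ring_scope.
Local Open Scope complex_scope.
Local Open Scope cstar_scope.

(** * Complex scalars and Cauchy sequences *)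

Section ComplexAbs.
Variable R : realType.
Implicit Types k l : R[i].

Definition cabs k : R := complex.Re `|k|.

Lemma cabsE k : (cabs k)%:C = `|k|.
Proof. exact: Re_normC. Qed.

Lemma cabs_ge0 k : 0 <= cabs k.
Proof. by rewrite -lecR cabsE normr_ge0. Qed.

Lemma cabsD k l : cabs (k + l) <= cabs k + cabs l.
Proof. by rewrite -lecR real_complexD !cabsE; exact: Num.Theory.ler_normD. Qed.

Lemma cabsM k l : cabs (k * l) = cabs k * cabs l.
Proof. by apply: (@complexI R); rewrite real_complexM !cabsE normrM. Qed.

Lemma cabs_conj k : cabs (conjc k) = cabs k.
Proof. by apply: (@complexI R); rewrite !cabsE normcJ. Qed.

Lemma cabs_eq0 k : cabs k = 0 -> k = 0.
Proof. by move=> h; apply/eqP; rewrite -normr_eq0 -cabsE h. Qed.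

Lemma Re_le_cabs k : `|complex.Re k| <= cabs k.
Proof. by rewrite -lecR cabsE; exact: normc_ge_Re. Qed.

Lemma cabs_i : cabs 'i%C = 1.
Proof. by rewrite /cabs normc_def /= expr0n expr1n add0r sqrtr1. Qed.

Lemma cabs_real (r : R) : cabs r%:C = `|r|.
Proof.
by apply: (@complexI R); rewrite cabsE normc_def /= expr0n addr0 sqrtr_sqr.
Qed.

Lemma conjc_real (r : R) : conjc r%:C = r%:C.
Proof. by rewrite /conjc /= oppr0. Qed.

Lemma real_complexN (r : R) : (- r)%:C = - r%:C :> R[i].
Proof. exact: (rmorphN (real_complex R)). Qed.

Lemma Im_le_cabs k : `|complex.Im k| <= cabs k.
Proof.
have := Re_le_cabs ('i%C * k); rewrite cabsM cabs_i mul1r.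
by case: k => a b /=; rewrite mul0r mul1r sub0r normrN.
Qed.

Lemma cabs_le k : cabs k <= `|complex.Re k| + `|complex.Im k|.
Proof.
case: k => a b; rewrite /= [X in cabs X]complexE.
by apply: le_trans (cabsD _ _) _; rewrite cabsM cabs_i mul1r !cabs_real.
Qed.

End ComplexAbs.

Section CauchySequences.

Lemma cauchy_seq_cvg (K : numFieldType) (V : completeNormedModType K) (u : nat -> V) :
  (forall e : K, 0 < e -> exists N, forall m n,
     (N <= m)%N -> (N <= n)%N -> `|u m - u n| < e) ->
  exists l, forall e : K, 0 < e -> exists N, forall n, (N <= n)%N -> `|u n - l| < e.
Proof.
move=> uc; have /cauchy_cvg/cvg_ex [l ul] : cauchy (u @ \oo).
  apply/cauchy_ballP => e e0; rewrite near_map2 /=.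
  have [N hN] := uc e e0.
  exists ([set m | (N <= m)%N], [set m | (N <= m)%N]).
    by split; exists N.
  by move=> [m n] [/= Nm Nn]; rewrite -ball_normE /ball_/=; exact: hN.
exists l => e e0; move/cvgrPdist_lt : ul => /(_ e e0)[N _ hN].
by exists N => n /hN /=; rewrite distrC.
Qed.

End CauchySequences.

(** * Unital algebras and square roots *)

(** The norm takes real values and completeness is that of sequences, because
    the unitization below serves only through its algebra and its norm; no
    topology is put on it. *)
HB.mixin Record Algebra_isUnitalCStar (R : realType) U
    of GRing.Algebra R[i] U := {
  star : U -> U;
  nrm : U -> R;
  starK : involutive star;
  starD : {morph star : x y / x + y};
  starZ : forall (k : R[i]) (x : U), star (k *: x) = conjc k *: star x;
  starM : forall x y : U, star (x * y) = star y * star x;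
  nrm_eq0 : forall x : U, nrm x = 0 -> x = 0;
  nrmD : forall x y : U, nrm (x + y) <= nrm x + nrm y;
  nrmZ : forall (k : R[i]) (x : U), nrm (k *: x) = complex.Re `|k| * nrm x;
  nrmM : forall x y : U, nrm (x * y) <= nrm x * nrm y;
  nrm_star_mul : forall x : U, nrm (star x * x) = nrm x ^+ 2;
  nrm_complete : forall u : nat -> U,
    (forall eps : R, 0 < eps -> exists N, forall m n,
      (N <= m)%N -> (N <= n)%N -> nrm (u m - u n) < eps) ->
    exists l, forall eps : R, 0 < eps -> exists N, forall n,
      (N <= n)%N -> nrm (u n - l) < eps
}.

#[short(type="unitalCstarType")]
HB.structure Definition UnitalCStar (R : realType) :=
  {U of GRing.Algebra R[i] U & Algebra_isUnitalCStar R U}.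

Section UnitalAlgebra.
Variables (R : realType) (U : unitalCstarType R).
Implicit Types (x y z a b c h k w : U) (t r : R).

Definition selfadj x := star x = x.
(** A form of positivity that is immediately usable in norm estimates; it
    agrees with being of the form star b * b by [upos_star_mul]. *)
Definition upos x := exists2 h, selfadj h & x = h * h.

Lemma nrmZr t x : nrm (t%:C *: x) = `|t| * nrm x.
Proof. by rewrite nrmZ -/(cabs _) cabs_real. Qed.

Lemma nrm0 : nrm (0 : U) = 0.
Proof. by rewrite -(scale0r 0) nrmZ normr0 mul0r. Qed.

Lemma starZr t x : star (t%:C *: x) = t%:C *: star x.
Proof. by rewrite starZ conjc_real. Qed.

Lemma scaleN1C x : (-1)%:C *: x = - x.
Proof. by rewrite real_complexN scaleN1r. Qed.

Lemma nrmN x : nrm (- x) = nrm x.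
Proof. by rewrite -scaleN1C nrmZr normrN1 mul1r. Qed.

Lemma nrm_ge0 x : 0 <= nrm x.
Proof.
have := nrmD x (- x); rewrite subrr nrm0 nrmN => h.
by rewrite -(pmulrn_lge0 _ (ltn0Sn 1)) mulr2n.
Qed.

Lemma nrmB x y : nrm (x - y) <= nrm x + nrm y.
Proof. by rewrite -(nrmN y); exact: nrmD. Qed.

Lemma nrmBC x y : nrm (x - y) = nrm (y - x).
Proof. by rewrite -nrmN opprB. Qed.

Lemma starN x : star (- x) = - star x.
Proof. by rewrite -!scaleN1C starZr. Qed.

Lemma starB x y : star (x - y) = star x - star y.
Proof. by rewrite starD starN. Qed.

Lemma star0 : star (0 : U) = 0.
Proof. by apply: (addrI (star 0)); rewrite -starD !addr0. Qed.

Lemma star1 : star (1 : U) = 1.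
Proof. by have := starM (star 1) (1 : U); rewrite mulr1 starK mulr1. Qed.

Lemma nrm_star x : nrm (star x) = nrm x.
Proof.
suff le y : nrm y <= nrm (star y) by apply/eqP; rewrite eq_le -{2}(starK x) !le.
have := nrm_star_mul y; have := nrmM (star y) y => + e; rewrite e expr2.
have := nrm_ge0 y; rewrite le_eqVlt => /predU1P[<- _|y0]; first exact: nrm_ge0.
by rewrite ler_pM2r.
Qed.

Lemma nrm_mul_star x : nrm (x * star x) = nrm x ^+ 2.
Proof. by rewrite -{1}(starK x) nrm_star_mul nrm_star. Qed.

Lemma nrm_sq h : selfadj h -> nrm (h * h) = nrm h ^+ 2.
Proof. by move=> hh; rewrite -{1}hh nrm_star_mul. Qed.

Lemma nrm1 : nrm (1 : U) = 1.
Proof.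
have := nrm_sq star1; rewrite mulr1 => /eqP.
rewrite -subr_eq0 expr2 -{1}[nrm 1]mulr1 -mulrBr mulf_eq0 => /orP[/eqP/nrm_eq0/eqP|].
  by rewrite oner_eq0.
by rewrite subr_eq0 => /eqP.
Qed.

Lemma star_mul_eq0 x : star x * x = 0 -> x = 0.
Proof.
move=> x0; apply: nrm_eq0; apply/eqP; have := nrm_star_mul x.
by rewrite x0 nrm0 => /esym/eqP; rewrite sqrf_eq0.
Qed.

Lemma selfadj_sq_eq0 h : selfadj h -> h * h = 0 -> h = 0.
Proof. by move=> hh; rewrite -{1}hh => /star_mul_eq0. Qed.

Lemma selfadjD x y : selfadj x -> selfadj y -> selfadj (x + y).
Proof. by rewrite /selfadj starD => -> ->. Qed.

Lemma selfadjN x : selfadj x -> selfadj (- x).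
Proof. by rewrite /selfadj starN => ->. Qed.

Lemma selfadjB x y : selfadj x -> selfadj y -> selfadj (x - y).
Proof. by move=> xx /selfadjN; exact: selfadjD. Qed.

Lemma selfadj1 : selfadj 1.
Proof. exact: star1. Qed.

Lemma selfadjZ t x : selfadj x -> selfadj (t%:C *: x).
Proof. by rewrite /selfadj starZr => ->. Qed.

Lemma selfadjM x y : selfadj x -> selfadj y -> GRing.comm x y -> selfadj (x * y).
Proof. by rewrite /selfadj starM => -> -> ->. Qed.

Lemma selfadj_star_mul x : selfadj (star x * x).
Proof. by rewrite /selfadj starM starK. Qed.

Lemma selfadj_real t : selfadj t%:C%:A.
Proof. exact/selfadjZ/selfadj1. Qed.

Lemma upos_selfadj x : upos x -> selfadj x.
Proof. by move=> [h hh ->]; exact: selfadjM. Qed.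

Lemma commZr (k : R[i]) x y : GRing.comm x y -> GRing.comm x (k *: y).
Proof. by rewrite /GRing.comm -scalerAr -scalerAl => ->. Qed.

Lemma commr_alg (k : R[i]) x : GRing.comm x k%:A.
Proof. exact/commZr/commr1. Qed.

Section SquareRoot.
Variable w : U.
Hypotheses (ws : selfadj w) (w1 : nrm w <= 1).

(** A fixed point z of z = (w + z * z) / 2 satisfies (1 - z) ^ 2 = 1 - w.  The
    iterates are polynomials in w with nonnegative coefficients, hence are
    dominated in norm by their values at w = 1, the reals [sqrt_majorant n]. *)
Fixpoint sqrt_iter n : U :=
  if n is n'.+1 then (2^-1)%:C *: (w + sqrt_iter n' * sqrt_iter n') else 0.

Fixpoint sqrt_majorant n : R :=
  if n is n'.+1 then 2^-1 * (1 + sqrt_majorant n' ^+ 2) else 0.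

Lemma sqrt_majorant_bound n : 0 <= sqrt_majorant n <= 1.
Proof.
by elim: n => [|n /andP[s0 s1]]/=; [rewrite lexx ler01|apply/andP; split; nra].
Qed.

Lemma sqrt_majorant_le n : sqrt_majorant n <= sqrt_majorant n.+1.
Proof.
have /andP[s0 s1] := sqrt_majorant_bound n; rewrite /=.
have : 0 <= (1 - sqrt_majorant n) ^+ 2 by exact: sqr_ge0.
nra.
Qed.

Lemma sqrt_majorant_mono m n : (m <= n)%N -> sqrt_majorant m <= sqrt_majorant n.
Proof.
move=> mn; rewrite -(subnK mn); elim: (n - m)%N => [//|d IH].
by rewrite addSn; exact: le_trans IH (sqrt_majorant_le _).
Qed.

Lemma sqrt_iter_comm c n : GRing.comm c w -> GRing.comm c (sqrt_iter n).
Proof.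
move=> cw; elim: n => [|n IH]/=; first exact: commr0.
by apply: commZr; apply: commrD => //; exact: commrM.
Qed.

Lemma sqrt_iter_selfadj n : selfadj (sqrt_iter n).
Proof.
elim: n => [|n IH]/=; first exact: star0.
by apply: selfadjZ; apply: selfadjD => //; exact: selfadjM.
Qed.

Lemma sqrt_iter_commz m n : GRing.comm (sqrt_iter m) (sqrt_iter n).
Proof. by apply: sqrt_iter_comm; apply/commr_sym/sqrt_iter_comm. Qed.

Lemma sqrt_iter_nrm n : nrm (sqrt_iter n) <= sqrt_majorant n.
Proof.
elim: n => [|n IH]/=; first by rewrite nrm0.
rewrite nrmZr ger0_norm ?invr_ge0// ler_pM2l ?invr_gt0//.
apply: le_trans (nrmD _ _) _; apply: lerD => //.
by apply: le_trans (nrmM _ _) _; rewrite expr2 ler_pM// nrm_ge0.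
Qed.

Lemma comm_sqB x y : GRing.comm x y -> x * x - y * y = (x - y) * (x + y).
Proof.
move=> xy; rewrite -!expr2 subrXX_comm// !big_ord_recl big_ord0 /=.
by rewrite expr0 mulr1 mul1r addr0 expr1.
Qed.

(** The increment z_{n+2} - z_{n+1} is half of
    (z_{n+1} - z_n) (z_{n+1} + z_n), and so is its real counterpart, so the
    domination passes from one increment to the next. *)
Lemma sqrt_iter_step n :
  nrm (sqrt_iter n.+1 - sqrt_iter n) <= sqrt_majorant n.+1 - sqrt_majorant n.
Proof.
elim: n => [|n IH]; first by rewrite !subr0; exact: sqrt_iter_nrm.
have -> : sqrt_iter n.+2 - sqrt_iter n.+1 =
    (2^-1)%:C *: ((sqrt_iter n.+1 - sqrt_iter n) * (sqrt_iter n.+1 + sqrt_iter n)).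
  rewrite -(comm_sqB (sqrt_iter_commz _ _)) [sqrt_iter n.+2]/= -/(sqrt_iter n.+1).
  rewrite {2}[sqrt_iter n.+1]/=.
  by rewrite -scalerBr opprD addrACA subrr add0r.
rewrite nrmZr ger0_norm ?invr_ge0//.
have -> : sqrt_majorant n.+2 - sqrt_majorant n.+1 =
    2^-1 * ((sqrt_majorant n.+1 - sqrt_majorant n) *
      (sqrt_majorant n.+1 + sqrt_majorant n)).
  rewrite [sqrt_majorant n.+2]/= -/(sqrt_majorant n.+1).
  by rewrite {2}[sqrt_majorant n.+1]/=; ring.
rewrite ler_pM2l ?invr_gt0//; apply: le_trans (nrmM _ _) _.
apply: ler_pM; rewrite ?nrm_ge0//.
by apply: le_trans (nrmD _ _) _; apply: lerD; exact: sqrt_iter_nrm.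
Qed.

Lemma sqrt_iter_dist m n : (m <= n)%N ->
  nrm (sqrt_iter n - sqrt_iter m) <= sqrt_majorant n - sqrt_majorant m.
Proof.
move=> mn; rewrite -(subnK mn); elim: (n - m)%N => [|d IH].
  by rewrite !subrr nrm0.
rewrite addSn -(subrK (sqrt_iter (d + m)) (sqrt_iter (d + m).+1)) -addrA.
apply: le_trans (nrmD _ _) _; have := sqrt_iter_step (d + m); lra.
Qed.

Lemma sqrt_iter_cauchy (eps : R) : 0 < eps -> exists N, forall m n,
  (N <= m)%N -> (N <= n)%N -> nrm (sqrt_iter m - sqrt_iter n) < eps.
Proof.
move=> e0.
have hs : has_sup (range sqrt_majorant).
  split; first by exists (sqrt_majorant 0), 0%N.
  by exists 1 => _ [n _ <-]; case/andP: (sqrt_majorant_bound n).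
have [_ [N _ <-] sN] := sup_adherent e0 hs.
have sb n : sqrt_majorant n <= sup (range sqrt_majorant).
  by apply: ub_le_sup; [exact: hs.2|exists n].
exists N.
have main m n : (N <= m)%N -> (m <= n)%N -> nrm (sqrt_iter n - sqrt_iter m) < eps.
  move=> Nm mn; apply: le_lt_trans (sqrt_iter_dist mn) _.
  have := sb n; have := sqrt_majorant_mono Nm; lra.
move=> m n Nm Nn; case: (leqP m n) => [mn|/ltnW nm].
  by rewrite nrmBC; exact: main.
exact: main.
Qed.

Definition nlim (u : nat -> U) x := forall eps : R, 0 < eps ->
  exists N, forall n, (N <= n)%N -> nrm (u n - x) < eps.

Lemma nlim_uniq u x y : nlim u x -> nlim u y -> x = y.
Proof.
move=> ux uy; apply/eqP; rewrite -subr_eq0; apply/eqP/nrm_eq0/eqP.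
rewrite eq_le nrm_ge0 andbT leNgt; apply/negP => p0.
have e0 : 0 < nrm (x - y) / 2 by rewrite divr_gt0.
have [N1 h1] := ux _ e0; have [N2 h2] := uy _ e0.
have := h1 _ (leq_maxl N1 N2); have := h2 _ (leq_maxr N1 N2).
set v := u _ => h3 h4.
have e : x - y = (v - y) - (v - x) by rewrite opprB [RHS]addrC addrA subrK.
have := nrmB (v - y) (v - x); rewrite -e; lra.
Qed.

Lemma nlim_le u x (v : nat -> U) y C : nlim u x ->
  (forall n, nrm (v n - y) <= C * nrm (u n - x)) -> nlim v y.
Proof.
move=> ux h eps e0.
have [C0|C0] := leP C 0.
  exists 0%N => n _; apply: le_lt_trans (h n) _; apply: le_lt_trans e0.
  by rewrite mulr_le0_ge0// nrm_ge0.
have [N hN] := ux _ (divr_gt0 e0 C0).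
exists N => n /hN; rewrite ltr_pdivlMr// mulrC; exact: le_lt_trans.
Qed.

Lemma nlim_shift u x : nlim u x -> nlim (fun n => u n.+1) x.
Proof. by move=> ux eps /ux[N h]; exists N => n Nn; apply: h; exact: leqW. Qed.

(** The bound on 1 - h makes h itself positive, so that roots can be iterated;
    h lies in the closed algebra generated by w, of which only the bicommutant
    property is retained. *)
Lemma sqrt_one_sub : exists h,
  [/\ selfadj h, h * h = 1 - w, nrm (1 - h) <= 1 &
     forall c, GRing.comm c w -> GRing.comm c h].
Proof.
have [z zl] := nrm_complete sqrt_iter sqrt_iter_cauchy.
have zs : star z = z.
  apply: (@nlim_uniq sqrt_iter) => //; apply: (@nlim_le sqrt_iter z _ _ 1) => // n.
  by rewrite mul1r -[in leLHS](sqrt_iter_selfadj n) -starB nrm_star.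
have zc c : GRing.comm c w -> GRing.comm c z.
  move=> cw; apply: (@nlim_uniq (fun n => c * sqrt_iter n)).
    by apply: (@nlim_le sqrt_iter z _ _ (nrm c)) => // n; rewrite -mulrBr nrmM.
  apply: (@nlim_le sqrt_iter z _ _ (nrm c)) => // n.
  by rewrite (sqrt_iter_comm n cw) -mulrBl mulrC nrmM.
have ze : z = (2^-1)%:C *: (w + z * z).
  apply: (@nlim_uniq (fun n => sqrt_iter n.+1)); first exact: nlim_shift.
  apply: (@nlim_le sqrt_iter z _ _ (1 + nrm z)) => // n.
  have -> : sqrt_iter n.+1 - (2^-1)%:C *: (w + z * z) =
      (2^-1)%:C *: (sqrt_iter n * (sqrt_iter n - z) + (sqrt_iter n - z) * z).
    rewrite [sqrt_iter n.+1]/= -scalerBr; congr (_ *: _).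
    by rewrite mulrBr mulrBl addrA subrK opprD addrACA subrr add0r.
  rewrite nrmZr ger0_norm ?invr_ge0//.
  have h1 := nrmD (sqrt_iter n * (sqrt_iter n - z)) ((sqrt_iter n - z) * z).
  have h2 := nrmM (sqrt_iter n) (sqrt_iter n - z); have h3 := nrmM (sqrt_iter n - z) z.
  have h4 : nrm (sqrt_iter n) <= 1.
    by apply: le_trans (sqrt_iter_nrm n) _; case/andP: (sqrt_majorant_bound n).
  have := ler_pM (nrm_ge0 _) (nrm_ge0 _) h4 (lexx (nrm (sqrt_iter n - z))).
  have := nrm_ge0 (sqrt_iter n - z); have := nrm_ge0 z.
  nra.
have z1 : nrm z <= 1.
  rewrite leNgt; apply/negP => z1.
  have [|N /(_ _ (leqnn N)) hN] := zl (nrm z - 1); first by rewrite subr_gt0.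
  have := nrmB (sqrt_iter N) (sqrt_iter N - z); rewrite opprB addrC subrK.
  have := sqrt_iter_nrm N; have /andP[_] := sqrt_majorant_bound N; lra.
exists (1 - z); split; first exact: (selfadjB selfadj1).
  have e : z - z * z = w - z.
    apply/eqP; rewrite subr_eq addrAC eq_sym subr_eq eq_sym; apply/eqP.
    rewrite {1 2}ze -scalerDl -real_complexD.
    by rewrite (_ : 2^-1 + 2^-1 = 1 :> R) ?scale1r//; lra.
  by rewrite mulrBr mulr1 mulrBl mul1r e opprB addrA subrK.
  by rewrite opprB addrC subrK.
move=> c cw; apply: commrB; [exact: commr1|exact: zc].
Qed.

End SquareRoot.
End UnitalAlgebra.

(** * Positive elements *)

Section Positivity.
Variables (R : realType) (U : unitalCstarType R).
Implicit Types (x y z a b c h k w : U) (t r : R).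

Lemma starZi x : star ('i%C *: x) = - ('i%C *: star x).
Proof.
rewrite starZ -scaleNr; congr (_ *: _); rewrite /conjc /=.
by congr Complex; rewrite oppr0.
Qed.

Lemma ii_scale x : 'i%C *: ('i%C *: x) = - x.
Proof. by rewrite scalerA -expr2 sqr_i scaleN1r. Qed.

Lemma star_mul_cart h k : selfadj h -> selfadj k ->
  star (h + 'i%C *: k) * (h + 'i%C *: k) = h * h + k * k + 'i%C *: (h * k - k * h).
Proof.
move=> hh kk; rewrite starD starZi hh kk mulrBl !mulrDr.
rewrite -!scalerAr -!scalerAl ii_scale scalerBr.
by rewrite opprB addrACA.
Qed.

Lemma mul_star_cart h k : selfadj h -> selfadj k ->
  (h + 'i%C *: k) * star (h + 'i%C *: k) = h * h + k * k - 'i%C *: (h * k - k * h).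
Proof.
move=> hh kk; rewrite starD starZi hh kk mulrBr !mulrDl.
rewrite -!scalerAr -!scalerAl ii_scale scalerBr.
by rewrite !opprB addrACA.
Qed.

Lemma scale_half x : (2^-1)%:C *: (x + x) = x.
Proof.
rewrite scalerDr -scalerDl -real_complexD (_ : 2^-1 + 2^-1 = 1 :> R) ?scale1r//.
lra.
Qed.

Lemma cartesian c : exists h k, [/\ selfadj h, selfadj k & c = h + 'i%C *: k].
Proof.
exists ((2^-1)%:C *: (c + star c)), ((2^-1)%:C *: ('i%C *: (star c - c))); split.
- by apply: selfadjZ; rewrite /selfadj starD starK addrC.
- by apply: selfadjZ; rewrite /selfadj starZi starB starK -scalerN opprB.
- rewrite scalerA [_ * (2^-1)%:C]mulrC -scalerA ii_scale opprB -scalerDr.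
  by rewrite addrACA subrr addr0 scale_half.
Qed.

Lemma nrm_alg t : 0 <= t -> nrm (t%:C%:A : U) = t.
Proof. by move=> t0; rewrite nrmZr nrm1 mulr1 ger0_norm. Qed.

(** As with cosine and sine: u = h + i k satisfies star u * u = t because h and
    k commute, so u has norm sqrt t, and h is the real part of u. *)
Lemma nrm_sq_le_of_sum_sq h k t : selfadj h -> selfadj k -> GRing.comm h k -> 0 <= t ->
  h * h + k * k = t%:C%:A -> nrm h ^+ 2 <= t.
Proof.
move=> hh kk hk t0 e; pose u := h + 'i%C *: k.
have nu : nrm u ^+ 2 = t.
  by rewrite -nrm_star_mul star_mul_cart// hk subrr scaler0 addr0 e nrm_alg.
have hu : (2 : R)%:C *: h = u + star u.
  rewrite /u starD starZi hh kk addrACA subrr addr0.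
  by rewrite (_ : 2 = 1 + 1 :> R) // real_complexD scalerDl scale1r.
have := nrmD u (star u); rewrite -hu nrmZr nrm_star ger0_norm//.
rewrite -nu; have := nrm_ge0 h; have := nrm_ge0 u; nra.
Qed.

(** The inequality |t - a| <= t expresses that the spectrum of a lies in
    [0, 2t]. *)
Lemma sqrt_exists a t : selfadj a -> nrm (t%:C%:A - a) <= t ->
  exists h, [/\ selfadj h, h * h = a, nrm ((Num.sqrt t)%:C%:A - h) <= Num.sqrt t &
     forall c, GRing.comm c a -> GRing.comm c h].
Proof.
move=> aa ta; have := le_trans (nrm_ge0 _) ta.
rewrite le_eqVlt => /predU1P[t0|t0].
  exists 0; rewrite /selfadj star0 mulr0 -t0 sqrtr0 scale0r subr0 nrm0; split=> //.
    apply/esym/nrm_eq0/eqP; rewrite eq_le nrm_ge0 andbT.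
    by move: ta; rewrite -t0 scale0r sub0r nrmN.
  by move=> c _; exact: commr0.
have ti : 0 < t^-1 by rewrite invr_gt0.
have [||h [hh he h1 hc]] := @sqrt_one_sub R U ((t^-1)%:C *: (t%:C%:A - a)).
- exact/selfadjZ/selfadjB/aa/selfadj_real.
- by rewrite nrmZr gtr0_norm// mulrC ler_pdivrMr ?mul1r.
have tt : (t^-1)%:C * t%:C = 1 :> R[i].
  by rewrite -real_complexM mulVf ?gt_eqF.
exists ((Num.sqrt t)%:C *: h); split.
- exact: selfadjZ.
- rewrite -scalerAl -scalerAr scalerA -real_complexM -expr2 sqr_sqrtr ?ltW// he.
  rewrite [(t^-1)%:C *: _]scalerBr [(t^-1)%:C *: _%:A]scalerA tt.
  rewrite scale1r opprB addrC subrK.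
  by rewrite scalerA mulrC tt scale1r.
- by rewrite -scalerBr nrmZr ger0_norm ?sqrtr_ge0// ler_piMr ?sqrtr_ge0.
- move=> c ca; apply/commZr/hc/commZr/commrB => //; exact: commr_alg.
Qed.

Lemma upos_of_nrm a t : selfadj a -> nrm (t%:C%:A - a) <= t -> upos a.
Proof. by move=> aa /(sqrt_exists aa)[h [hh he _ _]]; exists h. Qed.

(** The converse of [upos_of_nrm], for every t above the norm: t - h * h has a
    root k commuting with h, and [nrm_sq_le_of_sum_sq] bounds k. *)
Lemma upos_nrm a t : upos a -> nrm a <= t -> nrm (t%:C%:A - a) <= t.
Proof.
move=> [h hh ->] at_; have t0 := le_trans (nrm_ge0 _) at_.
have [||k [kk ke _ kc]] := @sqrt_exists (t%:C%:A - h * h) t.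
- by apply: selfadjB; [exact: selfadj_real|exact: selfadjM].
- by rewrite opprB addrC subrK.
rewrite -ke nrm_sq//; apply: (@nrm_sq_le_of_sum_sq k h) => //; last by rewrite ke subrK.
apply/commr_sym/kc/commrB; [exact: commr_alg|exact: commrM].
Qed.

Lemma upos_sqrt a : upos a -> exists h,
  [/\ upos h, h * h = a & forall c, GRing.comm c a -> GRing.comm c h].
Proof.
move=> pa.
have [h [hh he h1 hc]] := sqrt_exists (upos_selfadj pa) (upos_nrm pa (lexx _)).
by exists h; split => //; exact: upos_of_nrm h1.
Qed.

(** The norm criterion is additive in the pair (a, t). *)
Lemma uposD a b : upos a -> upos b -> upos (a + b).
Proof.
move=> pa pb; apply: (@upos_of_nrm _ (nrm a + nrm b)).
  by apply: selfadjD; exact: upos_selfadj.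
rewrite real_complexD scalerDl opprD addrACA.
by apply: le_trans (nrmD _ _) _; apply: lerD; exact: upos_nrm.
Qed.

Lemma uposZ a t : 0 <= t -> upos a -> upos (t%:C *: a).
Proof.
move=> t0 [h hh ->]; exists ((Num.sqrt t)%:C *: h); first exact: selfadjZ.
by rewrite -scalerAl -scalerAr scalerA -real_complexM -(expr2 (Num.sqrt t)) sqr_sqrtr.
Qed.

Lemma upos_alg_sub a t : selfadj a -> nrm a <= t -> upos (t%:C%:A - a).
Proof.
move=> aa at_; apply: (@upos_of_nrm _ t); first exact/selfadjB/aa/selfadj_real.
by rewrite opprB addrC subrK.
Qed.

Lemma upos_nrm_le a b t : upos a -> upos b -> a + b = t%:C%:A -> 0 <= t -> nrm a <= t.
Proof.
move=> [h hh ->] pb e t0; have [k [/upos_selfadj kk ke kc]] := upos_sqrt pb.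
rewrite nrm_sq//; apply: (@nrm_sq_le_of_sum_sq h k) => //; last by rewrite ke.
apply: kc; have -> : b = t%:C%:A - h * h by rewrite -e addrC addKr.
by apply: commrB; [exact: commr_alg|exact: commrM].
Qed.

Lemma nrm_le_add a b : upos a -> upos b -> nrm a <= nrm (a + b).
Proof.
move=> pa pb; have pab := uposD pa pb.
have p := uposD (upos_alg_sub (upos_selfadj pab) (lexx _)) pb.
apply: (upos_nrm_le pa p) (nrm_ge0 _).
by rewrite opprD [_%:A + _]addrA subrK subrKC.
Qed.

Lemma shift_cube r z : (r%:C%:A + z) * z * (r%:C%:A + z) =
  (2 * r)%:C *: (z * z) + ((r ^+ 2)%:C *: z + z * z * z).
Proof.
rewrite mulrDl -scalerAl mul1r mulrDr -[_ * _%:A]scalerAr mulr1.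
rewrite scalerDr scalerA mulrDl -scalerAl -real_complexM -expr2.
rewrite [(r ^+ 2)%:C *: z + r%:C *: _]addrC addrACA -scalerDl -real_complexD.
by congr (_%:C *: _ + _); ring.
Qed.

(** Put z = m * m and r = |c| ^ 2 = |z|.  The sum of star c * c and
    c * star c is a sum of squares, so c * star c is positive and
    |r - c * star c| <= r.  Since (r - c * star c) c = c (r + z), this bounds
    |c (r + z)| ^ 2 by r ^ 3, whereas that number is the norm of
    (r + z) z (r + z), which is at least 2 r (z * z), of norm
    2 r ^ 3.  Hence r = 0. *)
Lemma star_mul_eq_opp_sq c m : selfadj m -> star c * c = - (m * m) -> c = 0.
Proof.
move=> mm e; pose z := m * m; pose r := nrm c ^+ 2.
have zz : selfadj z by exact: selfadjM.
have nz : nrm z = r by rewrite /r -nrm_star_mul e nrmN.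
have r0 : 0 <= r by exact: sqr_ge0.
have pz : upos z by exists m.
have pcc : upos (c * star c).
  have [h [k [hh kk ce]]] := cartesian c.
  have -> : c * star c = (h * h + k * k) + (h * h + k * k) + z.
    rewrite -[z]opprK -[- z]e ce mul_star_cart// star_mul_cart//.
    by rewrite opprD addrA addrK.
  by apply: uposD => //; apply: uposD; apply: uposD;
    [exists h|exists k|exists h|exists k].
have h1 : nrm (r%:C%:A - c * star c) <= r.
  by apply: upos_nrm => //; rewrite nrm_mul_star.
have E : (r%:C%:A - c * star c) * c = c * (r%:C%:A + z).
  rewrite mulrBl mulrDr -mulrA e -scalerAl -scalerAr mul1r mulr1.
  by rewrite mulrN opprK.
pose d := r%:C%:A + z.
have nd : nrm (c * d) <= r * nrm c.
  by rewrite -E; apply: le_trans (nrmM _ _) _; rewrite ler_wpM2r ?nrm_ge0.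
have nd2 : nrm (d * z * d) = nrm (c * d) ^+ 2.
  rewrite -nrm_star_mul starM (selfadjD (selfadj_real U r) zz : star d = d).
  by rewrite [d * star c * _]mulrA -[d * star c * c]mulrA e mulrN mulNr nrmN.
have De : d * z * d = (2 * r)%:C *: (z * z) + ((r ^+ 2)%:C *: z + z * z * z).
  exact: shift_cube.
have : 2 * r * r ^+ 2 <= r ^+ 2 * r.
  have -> : r ^+ 2 * r = (r * nrm c) ^+ 2 by rewrite [RHS]exprMn -/r.
  have -> : 2 * r * r ^+ 2 = nrm ((2 * r)%:C *: (z * z)).
    by rewrite nrmZr nrm_sq// nz ger0_norm// mulr_ge0.
  apply: (@le_trans _ _ (nrm (d * z * d))).
    rewrite De; apply: nrm_le_add.
      by apply: uposZ; [exact: mulr_ge0|exists z].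
    apply: uposD; first by apply: uposZ => //; exact: sqr_ge0.
    exists (z * m); last by rewrite -!mulrA; congr (_ * _); rewrite /z !mulrA.
    by apply: selfadjM => //; rewrite /z /GRing.comm mulrA.
  by rewrite nd2 lerXn2r// nnegrE ?nrm_ge0// mulr_ge0 ?nrm_ge0.
move=> r3; have : r <= 0.
  rewrite leNgt; apply/negP => r_gt0.
  have : 0 < r ^+ 3 by exact: exprn_gt0.
  rewrite !exprS expr0 mulr1 in r3 *; nra.
rewrite /r => c0; apply: nrm_eq0; apply/eqP; rewrite -(sqrf_eq0 (nrm c)).
by rewrite eq_le c0 sqr_ge0.
Qed.

(** The element s * s is the absolute value of a, positive because it is a
    square. *)
Lemma abs_root_exists a : selfadj a -> exists s,
  [/\ selfadj s, s * s * (s * s) = a * a & forall c, GRing.comm c a -> GRing.comm c s].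
Proof.
move=> aa; have [|p [pp pe pc]] := @upos_sqrt (a * a); first by exists a.
have [s [/upos_selfadj ss se sc]] := upos_sqrt pp.
exists s; split; rewrite ?se// => c ca; apply/sc/pc; exact: commrM.
Qed.

(** Let a = star b * b, and let n = |a| - a be twice its negative part.  With
    |a| = s * s, the element c = b * n satisfies star c * c = - (s n) ^ 2, so
    it vanishes by [star_mul_eq_opp_sq]; this forces n = 0 and a = |a|. *)
Lemma upos_star_mul b : upos (star b * b).
Proof.
set a := star b * b; have aa : selfadj a by exact: selfadj_star_mul.
have [s [ss se sc]] := abs_root_exists aa.
have cas : GRing.comm a s by exact: sc.
pose n := s * s - a.
have nn : selfadj n by apply: selfadjB => //; exact: selfadjM.
have cns : GRing.comm s n.
  by apply: commrB; [exact: commrM|exact: commr_sym].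
have an : a * n = - (s * s * n).
  rewrite !mulrBr opprB se; congr (_ - _).
  by rewrite mulrA cas -mulrA cas mulrA.
have c0 : b * n = 0.
  apply: (@star_mul_eq_opp_sq _ (s * n)); first exact: selfadjM.
  rewrite starM nn mulrA -(mulrA n) -/a -(mulrA n) an mulrN; congr (- _).
  by rewrite !mulrA -cns.
have an0 : a * n = 0 by rewrite /a -mulrA c0 mulr0.
have ssn : s * s * n = 0 by rewrite -[LHS]opprK -an an0 oppr0.
have : n = 0.
  by apply: selfadj_sq_eq0 => //; rewrite {1}/n mulrBl ssn an0 subr0.
by move/eqP; rewrite subr_eq0 => /eqP <-; exists s.
Qed.

Lemma nrm_star_mul_le (u v : U) : nrm u ^+ 2 <= nrm (star u * u + star v * v).
Proof. by rewrite -nrm_star_mul; apply: nrm_le_add; exact: upos_star_mul. Qed.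

End Positivity.

(** * Closed ideals are hereditary *)

Section HereditaryIdeals.
Variables (R : realType) (U : unitalCstarType R).
Implicit Types (x y z a b c f h j k s w u v : U) (t r : R).

Lemma quarter_sub f :
  (4^-1)%:C%:A - f * (1 - f) = ((2^-1)%:C%:A - f) * ((2^-1)%:C%:A - f).
Proof.
have -> : ((2^-1)%:C%:A - f) * ((2^-1)%:C%:A - f) =
    (2^-1)%:C *: ((2^-1)%:C%:A - f) - ((2^-1)%:C *: f - f * f).
  by rewrite mulrBl -scalerAl mul1r mulrBr -scalerAr mulr1.
have q : 2^-1 * 2^-1 = 4^-1 :> R by rewrite -invfM -natrM.
rewrite scalerBr scalerA -real_complexM q mulrBr mulr1 !opprB -!addrA; congr (_ + _).
by rewrite [RHS]addrCA -opprD -scalerDr scale_half.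
Qed.

(** Because 1/4 - f (1 - f) is the square of 1/2 - f. *)
Lemma nrm_logistic f : upos f -> nrm f <= 1 -> nrm (f * (1 - f)) <= 4^-1.
Proof.
move=> [h hh fE] f1; have f_sa : selfadj f by rewrite fE; exact: selfadjM.
have [l [/upos_selfadj ll le lc]] : exists l, [/\ upos l, l * l = 1 - f &
    forall c, GRing.comm c (1 - f) -> GRing.comm c l].
  apply: upos_sqrt; have := upos_alg_sub f_sa f1; rewrite scale1r; exact.
have hl : GRing.comm h l.
  by apply: lc; apply: commrB; [exact: commr1|rewrite fE; exact: commrM].
have e : h * l * (h * l) = f * (1 - f).
  by rewrite -le fE !mulrA -(mulrA h l h) -hl mulrA.
rewrite -e nrm_sq; last exact: selfadjM.
have ff : GRing.comm f l by apply: lc; apply: commrB; [exact: commr1|].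
apply: (@nrm_sq_le_of_sum_sq _ _ (h * l) ((2^-1)%:C%:A - f)).
- exact: selfadjM.
- exact/selfadjB/f_sa/selfadj_real.
- apply: commrB; first exact: commr_alg.
  apply: commr_sym; apply: commrM => //.
  by rewrite fE; apply: commr_sym; apply: commrM.
- by rewrite invr_ge0.
by rewrite e -quarter_sub addrC subrK.
Qed.

Record ideal_axioms (J : U -> Prop) := IdealAxioms {
  idD : forall x y, J x -> J y -> J (x + y);
  idMl : forall x y, J x -> J (y * x);
  idMr : forall x y, J x -> J (x * y);
  id_closed : forall x,
    (forall eps : R, 0 < eps -> exists2 y, J y & nrm (x - y) < eps) -> J x
}.

(** For f = y / r in J, the elements u and u (1 - f) have the same distance to
    J, and the latter is dominated by (1 - f) y (1 - f) in J, whose norm is at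
    most r / 4 by [nrm_logistic].  Each step thus gains a factor 4, starting
    from |u| ^ 2 <= |y|. *)
Lemma hereditary_ideal_approx (J : U -> Prop) : ideal_axioms J ->
  forall n u y r, 0 <= r -> J y -> upos (y - star u * u) -> nrm y <= r ->
  exists2 j, J j & nrm (u - j) ^+ 2 <= r / 4 ^+ n.
Proof.
move=> [JD Jl Jr _]; elim=> [|n IH] u y r r0 Jy p yr.
  exists 0; first by rewrite -(mul0r y); exact: Jl.
  rewrite subr0 expr0 divr1; apply: le_trans yr.
  by have := nrm_le_add (upos_star_mul u) p; rewrite subrKC nrm_star_mul.
have py : upos y.
  by rewrite -(subrK (star u * u) y); apply: uposD => //; exact: upos_star_mul.
have := r0; rewrite le_eqVlt => /predU1P[rz|{}r0].
  have [j Jj h] := IH u y r r0 Jy p yr.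
  by exists j => //; apply: le_trans h _; rewrite -rz !mul0r.
pose f := (r^-1)%:C *: y; have [k kE] : exists k, k = 1 - f by exists (1 - f).
have ri : 0 < r^-1 by rewrite invr_gt0.
have pf : upos f by apply: uposZ => //; exact: ltW.
have f1 : nrm f <= 1 by rewrite nrmZr gtr0_norm// mulrC ler_pdivrMr ?mul1r.
have fs := upos_selfadj pf.
have ks : selfadj k by rewrite kE; exact/selfadjB/fs/selfadj1.
have k1 : nrm k <= 1 by rewrite kE; have := upos_nrm pf f1; rewrite scale1r.
have yE : y = r%:C *: f by rewrite scalerA -real_complexM divff ?gt_eqF// scale1r.
have Jf : J f by rewrite /f -[y]mul1r scalerAl; exact: Jl.
have [||||j Jj h] := IH (u * k) (k * y * k) (r / 4).
- by rewrite divr_ge0// ltW.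
- by apply: Jr; exact: Jl.
- have -> : k * y * k - star (u * k) * (u * k) = k * (y - star u * u) * k.
    by rewrite starM ks mulrBr mulrBl !mulrA.
  have [m ms ->] := p.
  have -> : k * (m * m) * k = star (m * k) * (m * k) by rewrite starM ms ks !mulrA.
  exact: upos_star_mul.
- rewrite yE -scalerAr -scalerAl nrmZr gtr0_norm// ler_pM2l//.
  rewrite -mulrA; apply: le_trans (nrmM _ _) _.
  rewrite -[leRHS]mul1r; apply: ler_pM; rewrite ?nrm_ge0//.
  by rewrite kE; exact: nrm_logistic.
exists (u * f + j); first by apply: JD => //; exact: Jl.
have -> : u - (u * f + j) = u * k - j by rewrite kE mulrBr mulr1 opprD addrA.
by rewrite [4 ^+ _]exprS invfM mulrA.
Qed.

Lemma hereditary_ideal (J : U -> Prop) u y : ideal_axioms J ->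
  J y -> upos (y - star u * u) -> J u.
Proof.
move=> JA Jy p; apply: (id_closed JA) => eps e0.
have e2 : 0 < eps ^+ 2 by exact: exprn_gt0.
pose r := nrm y.
have [n rn] : exists n, r / 4 ^+ n < eps ^+ 2.
  have q0 : 0 <= r / eps ^+ 2 by rewrite divr_ge0 ?nrm_ge0// ltW.
  exists (Num.bound (r / eps ^+ 2)).
  rewrite ltr_pdivrMr ?exprn_gt0// mulrC -ltr_pdivrMr//.
  apply: lt_le_trans (archi_boundP q0) _; rewrite -natrX ler_nat.
  exact/ltnW/ltn_expl.
have [j Jj jn] := hereditary_ideal_approx JA n (nrm_ge0 y) Jy p (lexx _).
exists j => //; rewrite -(@ltr_pXn2r _ 2)// ?nnegrE ?nrm_ge0 ?ltW//.
exact: le_lt_trans jn rn.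
Qed.

(** When s * s is |x|, the factors are twice the positive part and twice the
    negative part of x. *)
Lemma pos_neg_part_mul s x : GRing.comm s x -> s * s * (s * s) = x * x ->
  (s * s + x) * (s * s - x) = 0.
Proof.
move=> /commr_sym xs e.
have := comm_sqB (commrN (commr_sym (commrM xs xs))).
by rewrite mulrNN e subrr opprK => <-.
Qed.

Lemma pos_part_mul_abs s x : GRing.comm s x -> s * s * (s * s) = x * x ->
  (s * s + x) * x = (s * s + x) * (s * s).
Proof. by move=> sx e; apply/esym/eqP; rewrite -subr_eq0 -mulrBr pos_neg_part_mul. Qed.

(** The hypothesis says that x <= 0 modulo J, so its positive part vanishes
    modulo J.  Writing q for |x| + x and m * m for - (x + j), one has
    q |x| q = q x q = - q m m q - q j q; so star (s q) * (s q) is dominated by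
    the element - q j q of J. *)
Lemma pos_part_in_ideal (J : U -> Prop) s x j : ideal_axioms J ->
  selfadj s -> selfadj x -> GRing.comm s x -> s * s * (s * s) = x * x ->
  J j -> upos (- (x + j)) -> J (s * (s * s + x)).
Proof.
move=> JA ss xx sx e Jj [m mm me]; set q := s * s + x.
have qs : selfadj q by apply: selfadjD => //; exact: selfadjM.
have qx : q * x = q * (s * s) by exact: pos_part_mul_abs.
apply: (@hereditary_ideal J _ (- (q * j * q))) => //.
  by rewrite -mulN1r; apply: idMl => //; apply: idMr => //; exact: idMl.
rewrite starM ss qs (mulrA (q * s)) -(mulrA q s s) -qx -opprD -mulrDl -mulrDr.
rewrite addrC -mulNr -mulrN me -{1}qs -{1}mm mulrA -starM -mulrA; exact: upos_star_mul.
Qed.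

End HereditaryIdeals.

(** * Cutting a selfadjoint element at a level *)

Section Cuts.
Variables (R : realType) (U : unitalCstarType R).
Implicit Types (a e q s x z : U) (r t : R).

Lemma nrm_small_eq0 z r : (forall eps : R, 0 < eps -> nrm z <= eps * r) -> z = 0.
Proof.
move=> h; apply/nrm_eq0/eqP; rewrite eq_le nrm_ge0 andbT leNgt; apply/negP => z0.
have [r0|r0] := leP r 0.
  have := h 1 ltr01; rewrite mul1r; lra.
have := h (nrm z / (2 * r)) (divr_gt0 z0 (mulr_gt0 (ltr0Sn _ 1) r0)).
by rewrite invfM mulrA -mulrA mulVf ?gt_eqF//; lra.
Qed.

Lemma pos_part_eq0 s x : selfadj s -> selfadj x -> GRing.comm s x ->
  s * s * (s * s) = x * x -> s * (s * s + x) = 0 -> s * s + x = 0.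
Proof.
move=> ss xx sx e sq0; set q := s * s + x in sq0 *.
have qs : selfadj q by apply: selfadjD => //; exact: selfadjM.
have qs0 : q * s = 0 by rewrite -[LHS]starK starM qs ss sq0 star0.
apply: selfadj_sq_eq0 => //; rewrite {2}/q mulrDr pos_part_mul_abs// -/q mulrA qs0.
by rewrite mul0r addr0.
Qed.

Lemma nrm_le_of_pos_part_eq0 a s t : upos a -> selfadj s -> 0 <= t ->
  s * s + (a - t%:C%:A) = 0 -> nrm a <= t.
Proof.
move=> pa ss t0 e; apply: (@upos_nrm_le _ _ a (s * s)) => //; first by exists s.
by move/eqP: e; rewrite addrA subr_eq0 addrC => /eqP.
Qed.

(** If q = |x| + x is twice the positive part of x = a - t, then
    q a q = t q q + q |x| q, which is at least t q q; so q a = 0 would imply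
    q = 0 and then a <= t. *)
Lemma pos_part_mul_neq0 a s t : upos a -> selfadj s -> GRing.comm s a ->
  s * s * (s * s) = (a - t%:C%:A) * (a - t%:C%:A) -> 0 < t -> t < nrm a ->
  (s * s + (a - t%:C%:A)) * a <> 0.
Proof.
move=> pa ss sa_ e t0 ta; set x := a - t%:C%:A in e *; set q := s * s + x => qa0.
have as_ := upos_selfadj pa.
have xs : selfadj x by apply: selfadjB => //; exact: selfadj_real.
have qs : selfadj q by apply: selfadjD => //; exact: selfadjM.
have sx : GRing.comm s x by apply: commrB => //; exact: commr_alg.
have qx := pos_part_mul_abs sx e; rewrite -/q in qx.
have t2 : (Num.sqrt t)%:C * (Num.sqrt t)%:C = t%:C :> R[i].
  by rewrite -real_complexM -expr2 sqr_sqrtr// ltW.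
have sum0 : star ((Num.sqrt t)%:C *: q) * ((Num.sqrt t)%:C *: q) +
    star (s * q) * (s * q) = 0.
  rewrite starZr starM qs ss -scalerAl -scalerAr scalerA t2.
  rewrite mulrA -(mulrA q s s) -qx [q * x]mulrBr qa0 sub0r -scalerAr mulr1.
  by rewrite mulNr -scalerAl subrr.
have q0 : q = 0.
  apply: nrm_eq0; have := nrm_star_mul_le ((Num.sqrt t)%:C *: q) (s * q).
  rewrite sum0 nrm0 nrmZr exprMn => h; apply/eqP; rewrite -sqrf_eq0.
  have t_0 : 0 < `|Num.sqrt t| ^+ 2 by rewrite real_normK ?num_real// sqr_sqrtr// ltW.
  by rewrite eq_le sqr_ge0 andbT -(pmulr_rle0 _ t_0).
by have := nrm_le_of_pos_part_eq0 pa ss (ltW t0) q0; rewrite leNgt ta.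
Qed.

(** The hypothesis on e says that e annihilates the negative part of
    a - (1 - r ^ 2).  Then e (1 - a) star e is r ^ 2 (e star e) minus a positive
    element, which bounds the norm of e m, m the root of 1 - a. *)
Lemma nrm_sub_mul_le a s e r : upos a -> nrm a <= 1 -> selfadj s -> 0 <= r ->
  e * (s * s) = e * (a - (1 - r ^+ 2)%:C%:A) -> nrm (e - e * a) <= r * nrm e.
Proof.
move=> pa a1 ss r0 ee; have as_ := upos_selfadj pa.
have p1 : upos (1 - a) by have := upos_alg_sub as_ a1; rewrite scale1r.
have [m [/upos_selfadj ms me _]] := upos_sqrt p1.
have m1 : nrm m <= 1.
  rewrite -(@ler_pXn2r _ 2)// ?nnegrE ?nrm_ge0// expr1n -nrm_sq// me.
  by have := upos_nrm pa a1; rewrite scale1r.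
have -> : e - e * a = star (m * (m * star e)).
  by rewrite !starM starK ms -mulrA me mulrBr mulr1.
rewrite nrm_star; apply: le_trans (nrmM _ _) _.
suff h : nrm (m * star e) <= r * nrm e.
  by apply: le_trans h; rewrite ler_piMl ?nrm_ge0.
rewrite -(@ler_pXn2r _ 2)// ?nnegrE ?mulr_ge0 ?nrm_ge0//.
apply: le_trans (nrm_star_mul_le _ (s * star e)) _.
rewrite !starM starK ms ss !mulrA -(mulrA e m m) -(mulrA e s s) me ee.
have r2 : 1 - (1 - r ^+ 2)%:C%:A = (r ^+ 2)%:C%:A :> U.
  apply/eqP; rewrite eq_sym -subr_eq0 opprB addrA.
  by rewrite -scalerDl -real_complexD subrKC scale1r subrr.
rewrite -mulrDl -mulrDr addrA subrK r2 -scalerAr mulr1 -scalerAl nrmZr nrm_mul_star.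
by rewrite exprMn ger0_norm ?sqr_ge0.
Qed.

End Cuts.

(** * The unitization *)

Section CStarBasics.
Variables (R : realType) (A : cstarAlgType R).
Implicit Types (a b x : A) (k : R[i]).

Lemma rnormN a : rnorm (- a) = rnorm a.
Proof. by rewrite /rnorm normrN. Qed.

Lemma rnorm_eq0 a : rnorm a = 0 -> a = 0.
Proof. by move=> h; apply/eqP; rewrite -normr_eq0 -rnormE h. Qed.

Lemma rnormB a b : rnorm (a - b) <= rnorm a + rnorm b.
Proof. by rewrite -(rnormN b); exact: rnormD. Qed.

Lemma rnorm_adj_mul a : rnorm (adj a ** a) = rnorm a ^+ 2.
Proof.
apply: (@complexI R); rewrite rnormE norm_adj_mul -rnormE.
by rewrite expr2 -real_complexM -expr2.
Qed.

Lemma rnorm_adj a : rnorm (adj a) = rnorm a.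
Proof.
suff le (y : A) : rnorm y <= rnorm (adj y) by apply/eqP; rewrite eq_le -{2}(adjK a) !le.
have := rnorm_adj_mul y; have := @rnorm_cmul _ _ (adj y) y => + e; rewrite e expr2.
have := rnorm_ge0 y; rewrite le_eqVlt => /predU1P[<- _|y0]; first exact: rnorm_ge0.
by rewrite ler_pM2r.
Qed.

Lemma cmul0 a : a ** 0 = 0.
Proof. by apply: (addrI (a ** 0)); rewrite -cmulDr !addr0. Qed.

Lemma c0mul a : 0 ** a = 0.
Proof. by apply: (addrI (0 ** a)); rewrite -cmulDl !addr0. Qed.

Lemma adjB a b : adj (a - b) = adj a - adj b.
Proof. by apply/eqP; rewrite eq_sym subr_eq -adjD subrK. Qed.

End CStarBasics.

(** The scalars are taken as a module over themselves, so that the pair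
    inherits a module structure. *)
Definition unitization (R : realType) (A : cstarAlgType R) : Type := (A * R[i]^o)%type.

Section Unitization.
Variables (R : realType) (A : cstarAlgType R).
Local Notation T := (unitization A).
Implicit Types (u v w : T) (a b x y : A) (k l : R[i]) (r s : R).

HB.instance Definition _ := GRing.Lmodule.on T.

Definition uone : T := (0, 1).
Definition umul u v : T := (u.1 ** v.1 + v.2 *: u.1 + u.2 *: v.1, u.2 * v.2).
Definition ustar u : T := (adj u.1, conjc u.2).

(** The action of the unitization on A by left multiplication. *)
Definition uact u x : A := u.1 ** x + u.2 *: x.

Lemma umul1 : right_id uone umul.
Proof. by move=> [a k]; rewrite /umul /= cmul0 add0r scale1r scaler0 addr0 mulr1. Qed.

Lemma u1mul : left_id uone umul.
Proof. by move=> [a k]; rewrite /umul /= c0mul add0r scale1r scaler0 add0r mul1r. Qed.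

Lemma umulA : associative umul.
Proof.
move=> [a k] [b l] [c m]; rewrite /umul /= mulrA; congr pair.
rewrite !cmulDl !cmulDr -!cscaleAl -!cscaleAr !scalerDr !scalerA cmulA !addrA.
by rewrite [LHS](ACl (1*3*5*2*4*6*7))/= [m * l]mulrC [m * k]mulrC.
Qed.

Lemma umulDl : left_distributive umul +%R.
Proof.
move=> [a k] [b l] [c m]; rewrite /umul /= mulrDl; congr pair.
by rewrite cmulDl scalerDr scalerDl [X in X + _ = _]addrACA [LHS]addrACA.
Qed.

Lemma umulDr : right_distributive umul +%R.
Proof.
move=> [a k] [b l] [c m]; rewrite /umul /= mulrDr; congr pair.
by rewrite cmulDr scalerDr scalerDl [X in X + _ = _]addrACA [LHS]addrACA.
Qed.

Lemma uone_neq0 : uone != 0.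
Proof. by apply/eqP => -[/eqP]; rewrite oner_eq0. Qed.

HB.instance Definition _ := GRing.Zmodule_isNzRing.Build T
  umulA u1mul umul1 umulDl umulDr uone_neq0.

Lemma unitization_eq u v : u.1 = v.1 -> u.2 = v.2 -> u = v.
Proof. by case: u v => [a k] [b l] /= -> ->. Qed.

Lemma umul_1 u v : (u * v).1 = u.1 ** v.1 + v.2 *: u.1 + u.2 *: v.1.
Proof. by []. Qed.

Lemma umul_2 u v : (u * v).2 = u.2 * v.2.
Proof. by []. Qed.

Lemma uadd_1 u v : (u + v).1 = u.1 + v.1.
Proof. by []. Qed.

Lemma uadd_2 u v : (u + v).2 = u.2 + v.2.
Proof. by []. Qed.

Lemma uscale_1 k u : (k *: u).1 = k *: u.1.
Proof. by []. Qed.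

Lemma uscale_2 k u : (k *: u).2 = k * u.2.
Proof. by []. Qed.

Let uE := (umul_1, umul_2, uadd_1, uadd_2, uscale_1, uscale_2).

Lemma uscalerAl k u v : k *: (u * v) = (k *: u) * v.
Proof.
apply: unitization_eq; rewrite !uE ?mulrA//.
by rewrite !scalerDr !scalerA cscaleAl [k * v.2]mulrC.
Qed.

Lemma uscalerAr k u v : k *: (u * v) = u * (k *: v).
Proof.
apply: unitization_eq; rewrite !uE; last by rewrite mulrCA.
by rewrite !scalerDr !scalerA cscaleAr [k * u.2]mulrC.
Qed.

HB.instance Definition _ := GRing.Lmodule_isLalgebra.Build R[i] T uscalerAl.
HB.instance Definition _ := GRing.Lalgebra_isAlgebra.Build R[i] T uscalerAr.

Lemma ustarK : involutive ustar.
Proof. by move=> [a k]; rewrite /ustar /= adjK conjcK. Qed.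

Lemma ustarD : {morph ustar : u v / u + v}.
Proof.
move=> u v; apply: unitization_eq; first exact: adjD.
exact: (rmorphD (@conjc R)).
Qed.

Lemma ustarZ k u : ustar (k *: u) = conjc k *: ustar u.
Proof.
apply: unitization_eq; first exact: Defs.adjZ.
exact: (rmorphM (@conjc R)).
Qed.

Lemma ustarM u v : ustar (u * v) = ustar v * ustar u.
Proof.
apply: unitization_eq; last by rewrite uE mulrC; exact: (rmorphM (@conjc R)).
by rewrite uE /= !adjD adjM !Defs.adjZ addrAC.
Qed.

Lemma uactM u v x : uact (u * v) x = uact u (uact v x).
Proof.
rewrite /uact !uE !cmulDl !cmulDr !scalerDr -!cscaleAl -!cscaleAr cmulA scalerA.
by rewrite !addrA.
Qed.

Lemma uactD u v x : uact (u + v) x = uact u x + uact v x.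
Proof. by rewrite /uact !uE cmulDl scalerDl addrACA. Qed.

Lemma uactZ k u x : uact (k *: u) x = k *: uact u x.
Proof. by rewrite /uact !uE scalerDr cscaleAl scalerA. Qed.

Lemma adj_uact u x y : adj (uact u x) ** y = adj x ** uact (ustar u) y.
Proof.
rewrite /uact adjD adjM Defs.adjZ cmulDl cmulDr -cmulA; congr (_ + _).
by rewrite -cscaleAl cscaleAr.
Qed.

(** The operator norm of the left action alone is degenerate when A has a unit:
    it vanishes on the difference of the two units.  Including the scalar part
    restores a norm, and it is again a C*-norm, being a maximum of two
    C*-seminorms. *)
Definition ubound u r := (forall x, rnorm (uact u x) <= r * rnorm x) /\ cabs u.2 <= r.

Definition unorm u : R := inf [set r | ubound u r].

Lemma ubound_ge0 u r : ubound u r -> 0 <= r.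
Proof. by move=> [_]; apply: le_trans; exact: cabs_ge0. Qed.

Lemma ubound_sum u : ubound u (rnorm u.1 + cabs u.2).
Proof.
split; last by rewrite lerDr rnorm_ge0.
move=> x; apply: le_trans (rnormD _ _) _; rewrite mulrDl rnormZ lerD//.
exact: rnorm_cmul.
Qed.

Lemma ubound_has_inf u : has_inf [set r | ubound u r].
Proof.
split; first by exists (rnorm u.1 + cabs u.2); exact: ubound_sum.
by exists 0 => r /ubound_ge0.
Qed.

Lemma unorm_le u r : ubound u r -> unorm u <= r.
Proof. by move=> h; apply: ge_inf => //; exact: (ubound_has_inf u).2. Qed.

Lemma unorm_ge0 u : 0 <= unorm u.
Proof.
by apply: lb_le_inf; [exact: (ubound_has_inf u).1|move=> r /ubound_ge0].
Qed.

Lemma ubound_unorm u : ubound u (unorm u).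
Proof.
split=> [x|]; last first.
  by apply: lb_le_inf; [exact: (ubound_has_inf u).1|move=> r []].
have := rnorm_ge0 x; rewrite le_eqVlt => /predU1P[x0|x0].
  by have := (ubound_sum u).1 x; rewrite -x0 !mulr0.
rewrite -ler_pdivrMr//; apply: lb_le_inf; first exact: (ubound_has_inf u).1.
by move=> r [h _]; rewrite ler_pdivrMr.
Qed.

Lemma rnorm_fst_le u : rnorm u.1 <= 2 * unorm u.
Proof.
have [h1 h2] := ubound_unorm u.
have := rnorm_ge0 u.1; rewrite le_eqVlt => /predU1P[<-|p].
  by rewrite mulr_ge0// unorm_ge0.
rewrite -(ler_pM2r p) -expr2 -{1}rnorm_adj -rnorm_adj_mul adjK.
have -> : u.1 ** adj u.1 = uact u (adj u.1) - u.2 *: adj u.1 by rewrite /uact addrK.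
apply: le_trans (rnormB _ _) _; rewrite rnormZ rnorm_adj.
have := h1 (adj u.1); rewrite rnorm_adj -/(cabs u.2) => h3.
have := ler_pM (cabs_ge0 _) (rnorm_ge0 u.1) h2 (lexx _); lra.
Qed.

Lemma unorm_eq0 u : unorm u = 0 -> u = 0.
Proof.
move=> u0; apply: unitization_eq.
  apply/rnorm_eq0/eqP; rewrite eq_le rnorm_ge0 andbT.
  by have := rnorm_fst_le u; rewrite u0 mulr0.
apply/cabs_eq0/eqP; rewrite eq_le cabs_ge0 andbT -u0.
exact: (ubound_unorm u).2.
Qed.

Lemma unormD u v : unorm (u + v) <= unorm u + unorm v.
Proof.
apply: unorm_le; have [hu ku] := ubound_unorm u; have [hv kv] := ubound_unorm v.
split=> [x|]; last exact: le_trans (cabsD _ _) (lerD _ _).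
by rewrite uactD mulrDl; apply: le_trans (rnormD _ _) (lerD _ _).
Qed.

Lemma unormM u v : unorm (u * v) <= unorm u * unorm v.
Proof.
apply: unorm_le; have [hu ku] := ubound_unorm u; have [hv kv] := ubound_unorm v.
split=> [x|]; last by rewrite umul_2 cabsM ler_pM ?cabs_ge0.
rewrite uactM; apply: le_trans (hu _) _; rewrite -mulrA ler_wpM2l ?unorm_ge0//.
Qed.

Lemma unormZ_le k u : unorm (k *: u) <= cabs k * unorm u.
Proof.
apply: unorm_le; have [hu ku] := ubound_unorm u; split=> [x|].
  by rewrite uactZ rnormZ -mulrA ler_wpM2l// -/(cabs k) cabs_ge0.
by rewrite uscale_2 cabsM ler_wpM2l// cabs_ge0.
Qed.

Lemma unormZ k u : unorm (k *: u) = cabs k * unorm u.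
Proof.
have [->|k0] := eqVneq k 0.
  rewrite scale0r /cabs normr0 mul0r; apply/eqP; rewrite eq_le unorm_ge0 andbT.
  by have := unormZ_le 0 0; rewrite scale0r /cabs normr0 mul0r.
apply/eqP; rewrite eq_le unormZ_le andTb.
have kk : cabs k * cabs k^-1 = 1 by rewrite -cabsM divff// /cabs normr1.
rewrite -[u in leLHS](scale1r u) -(mulVf k0) -scalerA.
have := unormZ_le k^-1 (k *: u) => /(ler_wpM2l (cabs_ge0 k)).
by rewrite mulrA kk mul1r.
Qed.

(** On the action: |u x| ^ 2 = |adj x ** (star u * u) x|. *)
Lemma unorm_sq_le u : unorm u ^+ 2 <= unorm (ustar u * u).
Proof.
have s0 := unorm_ge0 (ustar u * u); have [h k] := ubound_unorm (ustar u * u).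
rewrite -[leRHS]sqr_sqrtr// lerXn2r// ?nnegrE ?unorm_ge0 ?sqrtr_ge0//.
apply: unorm_le; split=> [x|]; last first.
  rewrite -(@ler_pXn2r _ 2)// ?nnegrE ?cabs_ge0 ?sqrtr_ge0// sqr_sqrtr//.
  by apply: le_trans k; rewrite umul_2 cabsM cabs_conj expr2.
rewrite -(@ler_pXn2r _ 2)// ?nnegrE ?rnorm_ge0 ?mulr_ge0 ?rnorm_ge0 ?sqrtr_ge0//.
rewrite exprMn sqr_sqrtr// -rnorm_adj_mul adj_uact -uactM.
apply: le_trans (rnorm_cmul _ _) _.
by rewrite rnorm_adj expr2 mulrCA ler_wpM2l ?rnorm_ge0.
Qed.

Lemma unorm_star_le u : unorm u <= unorm (ustar u).
Proof.
have := le_trans (unorm_sq_le u) (unormM _ _); rewrite expr2.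
have := unorm_ge0 u; rewrite le_eqVlt => /predU1P[<- _|u0]; first exact: unorm_ge0.
by rewrite ler_pM2r.
Qed.

Lemma unorm_star_mul u : unorm (ustar u * u) = unorm u ^+ 2.
Proof.
apply/eqP; rewrite eq_le unorm_sq_le andbT; apply: le_trans (unormM _ _) _.
by rewrite expr2 ler_wpM2r ?unorm_ge0// -{2}(ustarK u) unorm_star_le.
Qed.

Lemma real_cauchy_cvg (f : nat -> R) :
  (forall e : R, 0 < e -> exists N, forall m n,
     (N <= m)%N -> (N <= n)%N -> `|f m - f n| < e) ->
  exists l : R, forall e : R, 0 < e -> exists N, forall n, (N <= n)%N -> `|f n - l| < e.
Proof. exact: (@cauchy_seq_cvg R R^o). Qed.

Lemma unorm_complete (f : nat -> T) :
  (forall eps : R, 0 < eps -> exists N, forall m n,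
     (N <= m)%N -> (N <= n)%N -> unorm (f m - f n) < eps) ->
  exists l : T, forall eps : R, 0 < eps -> exists N, forall n,
     (N <= n)%N -> unorm (f n - l) < eps.
Proof.
move=> fc.
have [a ha] : exists a : A, forall e : R[i], 0 < e -> exists N, forall n,
    (N <= n)%N -> `|(f n).1 - a| < e.
  apply: cauchy_seq_cvg => e e0.
  have re0 : 0 < complex.Re e by rewrite -ltcR RRe_real ?gtr0_real.
  have [|N hN] := fc (complex.Re e / 2); first by rewrite divr_gt0.
  exists N => m n Nm Nn; have := hN m n Nm Nn.
  rewrite -rnormE -(RRe_real (gtr0_real e0)) ltcR.
  have := rnorm_fst_le (f m - f n); rewrite /=; lra.
have proj (p : R[i] -> R) : (forall z w : R[i], `|p z - p w| <= cabs (z - w)) ->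
    exists l : R, forall e : R, 0 < e -> exists N, forall n,
    (N <= n)%N -> `|p (f n).2 - l| < e.
  move=> hp; apply: real_cauchy_cvg => e /fc[N hN].
  exists N => m n Nm Nn; apply: le_lt_trans (hp _ _) (le_lt_trans _ (hN m n Nm Nn)).
  exact: (ubound_unorm (f m - f n)).2.
have [b hb] : exists l : R, forall e : R, 0 < e -> exists N, forall n,
    (N <= n)%N -> `|complex.Re (f n).2 - l| < e.
  by apply: proj => z w; rewrite -raddfB; exact: Re_le_cabs.
have [c hc] : exists l : R, forall e : R, 0 < e -> exists N, forall n,
    (N <= n)%N -> `|complex.Im (f n).2 - l| < e.
  by apply: proj => z w; rewrite -raddfB; exact: Im_le_cabs.
exists (a, b +i* c) => e e0; have e3 : 0 < e / 3 by rewrite divr_gt0.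
have e3C : 0 < (e / 3)%:C :> R[i] by rewrite ltcR.
have [N1 h1] := ha _ e3C; have [N2 h2] := hb _ e3; have [N3 h3] := hc _ e3.
exists (maxn N1 (maxn N2 N3)) => n; rewrite !geq_max => /and3P[/h1 + /h2 + /h3].
rewrite -rnormE ltcR => d1 d2 d3.
apply: le_lt_trans (unorm_le (ubound_sum _)) _ => /=.
have := cabs_le ((f n).2 - (b +i* c)); rewrite !raddfB /=; lra.
Qed.

HB.instance Definition _ := Algebra_isUnitalCStar.Build R T
  ustarK ustarD ustarZ ustarM unorm_eq0 unormD unormZ unormM unorm_star_mul
  unorm_complete.

End Unitization.

(** * The embedding into the unitization *)

Section Embedding.
Variables (R : realType) (A : cstarAlgType R).
Local Notation T := (unitization A).
Implicit Types (a b x y : A) (u v : T).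

Definition uemb a : T := (a, 0).

Lemma uembD a b : uemb (a + b) = uemb a + uemb b.
Proof. by apply: unitization_eq; rewrite //= addr0. Qed.

Lemma uembZ k a : uemb (k *: a) = k *: uemb a.
Proof. by apply: unitization_eq => //; rewrite uscale_2 /= mulr0. Qed.

Lemma uembB a b : uemb (a - b) = uemb a - uemb b.
Proof. by rewrite -scaleN1r uembD uembZ scaleN1r. Qed.

Lemma uembM a b : uemb (a ** b) = uemb a * uemb b.
Proof. by apply: unitization_eq; rewrite /= ?mulr0// !scale0r !addr0. Qed.

Lemma uemb_adj a : uemb (adj a) = star (uemb a).
Proof. by apply: unitization_eq => //; exact: esym (conjc_real 0). Qed.

Lemma uemb0 : uemb 0 = 0.
Proof. by []. Qed.

Lemma uemb_inj : injective uemb.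
Proof. by move=> a b []. Qed.

Lemma mul_uemb u a : u * uemb a = uemb (u * uemb a).1.
Proof. by apply: unitization_eq; rewrite //= mulr0. Qed.

(** Testing the left action on adj a gives the lower bound. *)
Lemma nrm_uemb a : nrm (uemb a) = rnorm a.
Proof.
apply/eqP; rewrite eq_le; apply/andP; split.
  apply: unorm_le; split=> [x|]; last by rewrite /cabs normr0 rnorm_ge0.
  by rewrite /uact scale0r addr0 rnorm_cmul.
have := rnorm_ge0 a; rewrite [0 <= _]le_eqVlt => /predU1P[<-|a0]; first exact: nrm_ge0.
have := (ubound_unorm (uemb a)).1 (adj a); rewrite /uact scale0r addr0 /=.
by rewrite -{1}(adjK a) rnorm_adj_mul rnorm_adj expr2 ler_pM2r.
Qed.

Lemma upos_uemb a : cpos a -> upos (uemb a).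
Proof. by move=> [b ->]; rewrite uembM uemb_adj; exact: upos_star_mul. Qed.

Lemma cpos_adj a : cpos a -> adj a = a.
Proof. by move=> [b ->]; rewrite adjM adjK. Qed.

End Embedding.

(** * Local units in hereditary subalgebras *)

Section ClosedSets.
Variables (R : realType) (V : normedModType R[i]).

Lemma closed_of_approx (S : V -> Prop) :
  (forall x,
    (forall eps : R, 0 < eps -> exists2 y, S y & rnorm (x - y) < eps) -> S x) ->
  closed (S : set V).
Proof.
move=> h x xS; apply: h => eps e0.
have [|y [Sy xy]] := xS (ball x eps%:C).
  by apply: nbhsx_ballx; rewrite ltcR.
exists y => //; move: xy; rewrite -ball_normE /ball_ /=.
by rewrite -rnormE ltcR.
Qed.

Lemma csub_approx (S : closedSubspace V) x :
  (forall eps : R, 0 < eps -> exists2 y, S y & rnorm (x - y) < eps) -> S x.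
Proof.
move=> h; apply: csub_closed => W /nbhs_ballP [e e0 eW].
have re0 : 0 < complex.Re e by rewrite -ltcR RRe_real ?gtr0_real.
have [y Sy xy] := h _ re0; exists y; split => //; apply: eW.
by rewrite -ball_normE /ball_ /= -rnormE -(RRe_real (gtr0_real e0)) ltcR.
Qed.

End ClosedSets.

Section Annihilator.
Variables (R : realType) (A : cstarAlgType R) (D : cstarSubalg A).
Variables (g : unitization A) (gs : selfadj g).
Implicit Types (x y d : A).

Definition ann_set x := [/\ D x, uemb x * g = 0 & g * uemb x = 0].

Lemma ann0 : ann_set 0.
Proof. by split; [exact: csub0|exact: mul0r|exact: mulr0]. Qed.

Lemma annD x y : ann_set x -> ann_set y -> ann_set (x + y).
Proof.
move=> [Dx x1 x2] [Dy y1 y2]; split; first exact: csubD.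
  by rewrite uembD mulrDl x1 y1 addr0.
by rewrite uembD mulrDr x2 y2 addr0.
Qed.

Lemma annZ (k : R[i]) x : ann_set x -> ann_set (k *: x).
Proof.
move=> [Dx x1 x2]; split; first exact: csubZ.
  by rewrite uembZ -scalerAl x1 scaler0.
by rewrite uembZ -scalerAr x2 scaler0.
Qed.

Lemma ann_closed : closed (ann_set : set A).
Proof.
apply: closed_of_approx => x h; split.
- by apply: csub_approx => eps /h[y [Dy _ _] xy]; exists y.
- apply: (@nrm_small_eq0 _ _ _ (nrm g)) => eps /h[y [_ y0 _] xy].
  rewrite -(subrK y x) uembD mulrDl y0 addr0; apply: le_trans (nrmM _ _) _.
  by rewrite ler_wpM2r ?nrm_ge0// nrm_uemb ltW.
- apply: (@nrm_small_eq0 _ _ _ (nrm g)) => eps /h[y [_ _ y0] xy].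
  rewrite -(subrK y x) uembD mulrDr y0 addr0; apply: le_trans (nrmM _ _) _.
  by rewrite mulrC ler_wpM2r ?nrm_ge0// nrm_uemb ltW.
Qed.

Lemma ann_mul x y : ann_set x -> ann_set y -> ann_set (x ** y).
Proof.
move=> [Dx x1 x2] [Dy y1 y2]; split; first exact: csa_mul.
  by rewrite uembM -mulrA y1 mulr0.
by rewrite uembM mulrA x2 mul0r.
Qed.

Lemma ann_adj x : ann_set x -> ann_set (adj x).
Proof.
move=> [Dx x1 x2]; split; first exact: csa_adj.
  by rewrite uemb_adj -[RHS]star0 -x2 starM gs.
by rewrite uemb_adj -[RHS]star0 -x1 starM gs.
Qed.

Definition annihilator : cstarSubalg A :=
  @CStarSubalg _ _ (ClosedSubspace ann0 annD annZ ann_closed) ann_mul ann_adj.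

(** If a = adj b ** b and d - a = adj c ** c with d g = 0, then
    star (b g) * (b g) + star (c g) * (c g) = g d g = 0, and both terms are
    positive. *)
Lemma annihilator_hereditary : hereditary D -> hereditary annihilator.
Proof.
move=> hD a d pa ad [Dd d1 d2]; have [b ab] := pa; have [c dac] := ad.
have bg : uemb b * g = 0.
  apply: nrm_eq0; have := nrm_star_mul_le (uemb b * g) (uemb c * g).
  have -> : star (uemb b * g) * (uemb b * g) + star (uemb c * g) * (uemb c * g) = 0.
    rewrite !starM gs !mulrA -[g * _ * _]mulrA -(mulrA g (star (uemb c))).
    rewrite -!uemb_adj -!uembM -ab -dac -mulrDl -mulrDr -uembD subrKC.
    by rewrite d2 mul0r.
  by rewrite nrm0 => h; apply/eqP; rewrite -sqrf_eq0 eq_le h sqr_ge0.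
have ag : uemb a * g = 0 by rewrite ab uembM -mulrA bg mulr0.
split => //; first exact: hD ad Dd.
by rewrite -[LHS]starK starM gs -uemb_adj (cpos_adj pa) ag star0.
Qed.

End Annihilator.

Section LocalUnit.
Variables (R : realType) (A : cstarAlgType R).
Implicit Types (x y d : A).

(** Let q and g be twice the positive and negative parts of a0 - (1 - r ^ 2).
    On the annihilator of g in D, a0 is at least 1 - r ^ 2 and is a unit up to
    r by [nrm_sub_mul_le].  This annihilator contains a0 q q a0, which lies in D
    because it is dominated by a multiple of a0 a0, and which is nonzero by
    [pos_part_mul_neq0]. *)
Lemma local_unit (D : cstarSubalg A) (a0 : A) (r : R) :
  hereditary D -> D a0 -> cpos a0 -> rnorm a0 = 1 -> 0 < r < 1 ->
  exists D1 : cstarSubalg A, [/\ hereditary D1, nonzero_subalg D1,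
    forall d, D1 d -> D d & forall d, D1 d ->
    rnorm (d - d ** a0) <= r * rnorm d /\ rnorm (d - a0 ** d) <= r * rnorm d].
Proof.
move=> hD Da0 pa0 n1 /andP[r0 r1].
set a := uemb a0; have pa : upos a by exact: upos_uemb.
have as_ := upos_selfadj pa; have na : nrm a = 1 by rewrite nrm_uemb.
pose t := 1 - r ^+ 2; have t0 : 0 < t by rewrite subr_gt0 expr_lt1// ltW.
have t1 : t < nrm a by rewrite na ltrBlDr ltrDl exprn_gt0.
have xs : selfadj (a - t%:C%:A) by apply: selfadjB => //; exact: selfadj_real.
have [s [ss se sc]] := abs_root_exists xs.
have sa_ : GRing.comm s a.
  by apply/commr_sym/sc/commrB => //; exact: commr_alg.
have sx : GRing.comm s (a - t%:C%:A) by apply: commrB => //; exact: commr_alg.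
pose q := s * s + (a - t%:C%:A); pose g := s * s - (a - t%:C%:A).
have qs : selfadj q by apply: selfadjD => //; exact: selfadjM.
have gs : selfadj g by apply: selfadjB => //; exact: selfadjM.
have aq : GRing.comm a q.
  apply: commrD; first by apply: commrM; exact: commr_sym.
  by apply: commrB => //; exact: commr_alg.
have ag : GRing.comm a g.
  apply: commrB; first by apply: commrM; exact: commr_sym.
  by apply: commrB => //; exact: commr_alg.
have qg : q * g = 0 by exact: pos_neg_part_mul.
have gq : g * q = 0 by rewrite -[LHS]starK starM qs gs qg star0.
have a0s : adj a0 = a0 by exact: cpos_adj.
exists (annihilator D gs); split.
- exact: annihilator_hereditary.
- pose c := (q * a).1; have cE : uemb c = q * a by rewrite [RHS]mul_uemb.
  have cc : uemb (adj c ** c) = a * q * (q * a).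
    by rewrite uembM uemb_adj cE starM qs as_.
  exists (adj c ** c).
    split; last first.
    + by rewrite cc aq !mulrA gq !mul0r.
    + by rewrite cc -!mulrA ag (mulrA q g) qg mul0r !mulr0.
    apply: (hD _ ((nrm q ^+ 2)%:C *: (a0 ** a0))); [by exists c| |].
      have [m ms me] : upos ((nrm q ^+ 2)%:C%:A - q * q).
        by apply: upos_alg_sub; [exact: selfadjM|rewrite nrm_sq].
      exists (m * a).1; apply: uemb_inj.
      rewrite uembM uemb_adj -mul_uemb starM ms as_ uembB uembZ uembM cc.
      have -> : a * m * (m * a) = a * (m * m) * a by rewrite !mulrA.
      rewrite -me mulrBr mulrBl -scalerAr mulr1 -scalerAl.
      by rewrite -/a !mulrA.
    by apply: csubZ; exact: csa_mul.
  apply/eqP => c0; apply: (pos_part_mul_neq0 pa ss sa_ se t0 t1).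
  rewrite -/q; apply: star_mul_eq0; rewrite -cE -uemb_adj -uembM.
  by rewrite c0.
- by move=> d [].
have right d : annihilator D gs d -> rnorm (d - d ** a0) <= r * rnorm d.
  move=> [Dd d1 d2]; rewrite -!nrm_uemb uembB uembM.
  apply: (nrm_sub_mul_le pa _ ss (ltW r0)); first by rewrite na.
  by apply/eqP; rewrite -subr_eq0 -mulrBr -/t d1.
move=> d Dd; split; first exact: right.
by have := right (adj d) (csa_adj Dd); rewrite -{1}a0s -adjM -adjB !rnorm_adj.
Qed.

End LocalUnit.

(** * Ideals of B and ideals of its unitization *)

Section IdealsInUnitization.
Variables (R : realType) (B : cstarAlgType R) (J : closedIdeal B).
Local Notation U := (unitization B).
Implicit Types (u v w : U) (x y : B).

Definition uideal u := u.2 = 0 /\ J u.1.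

Lemma uideal_axioms : ideal_axioms uideal.
Proof.
split.
- move=> u v [u2 Ju] [v2 Jv]; split; first by rewrite uadd_2 u2 v2 addr0.
  by rewrite uadd_1; exact: csubD.
- move=> u v [u2 Ju]; split; first by rewrite umul_2 u2 mulr0.
  rewrite umul_1 u2 scale0r addr0; apply: csubD; first exact: cid_mulr.
  exact: csubZ.
- move=> u v [u2 Ju]; split; first by rewrite umul_2 u2 mul0r.
  rewrite umul_1 u2 scale0r addr0; apply: csubD; first exact: cid_mull.
  exact: csubZ.
- move=> u h; split.
    apply/cabs_eq0/eqP; rewrite eq_le cabs_ge0 andbT leNgt; apply/negP => /h.
    move=> [v [v2 _]]; have [_ +] := ubound_unorm (u - v).
    rewrite uadd_2 /= v2 subr0 => h1 h2; have := le_lt_trans h1 h2.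
    by rewrite ltxx.
  apply: csub_approx => eps e0.
  have [|v [_ Jv] uv] := h (eps / 2); first by rewrite divr_gt0.
  exists v.1 => //; have := rnorm_fst_le (u - v); rewrite uadd_1 /=; lra.
Qed.

(** With u = star x, star u * u = x * star x lies in J, so J being hereditary
    gives u in J. *)
Lemma cid_adj x : J x -> J (adj x).
Proof.
move=> Jx; have JA := uideal_axioms.
suff [] : uideal (uemb (adj x)) by [].
have Jux : uideal (uemb x) by split.
apply: (@hereditary_ideal _ _ _ _ (uemb x * star (uemb x)) JA).
  exact: (idMr JA).
by rewrite uemb_adj starK subrr; exists 0; rewrite ?mulr0//; exact: star0.
Qed.

Lemma uideal_bimod u v x : J x -> J (u * uemb x * v).1.
Proof.
move=> Jx; have JA := uideal_axioms.
suff [] : uideal (u * uemb x * v) by [].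
by apply: (idMr JA); apply: (idMl JA); split.
Qed.

End IdealsInUnitization.

(** * The inclusion and its aperiodic core *)

Section Inclusion.
Variables (R : realType) (B : cstarAlgType R) (A : cstarSubalg B).
Local Notation T := (csa_type A).
Local Notation V := (unitization T).
Local Notation U := (unitization B).

Definition uincl (v : V) : U := (csa_val v.1, v.2).

Lemma uincl_1 v : (uincl v).1 = csa_val v.1.
Proof. by []. Qed.

Lemma uincl_2 v : (uincl v).2 = v.2.
Proof. by []. Qed.

Lemma uinclD v w : uincl (v + w) = uincl v + uincl w.
Proof.
apply: unitization_eq; first by rewrite !(uincl_1, uadd_1) csa_valD.
by rewrite !(uincl_2, uadd_2).
Qed.

Lemma uinclZ k v : uincl (k *: v) = k *: uincl v.
Proof.
apply: unitization_eq; first by rewrite !(uincl_1, uscale_1) csa_valZ.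
by rewrite !(uincl_2, uscale_2).
Qed.

Lemma uinclB v w : uincl (v - w) = uincl v - uincl w.
Proof. by rewrite -scaleN1r uinclD uinclZ scaleN1r. Qed.

Lemma uinclM v w : uincl (v * w) = uincl v * uincl w.
Proof.
apply: unitization_eq; last exact: esym (umul_2 (uincl v) (uincl w)).
apply: etrans (esym (umul_1 (uincl v) (uincl w))).
rewrite (uincl_1 (v * w)) (umul_1 v w) (uincl_1 v) (uincl_1 w).
by rewrite 2!csa_valD csa_valM !csa_valZ.
Qed.

Lemma uincl1 : uincl 1 = 1.
Proof.
apply: unitization_eq; last by [].
by have := csa_valZ 0 (0 : T); rewrite !scale0r.
Qed.

Lemma uincl_star v : uincl (star v) = star (uincl v).
Proof. by apply: unitization_eq; [exact: csa_val_adj|by []]. Qed.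

Lemma uincl_uemb (a : T) : uincl (uemb a) = uemb (csa_val a).
Proof. by []. Qed.

Section TrivialMeet.
Variable J : closedIdeal B.
Hypothesis JA0 : trivial_meet A J.

(** Let t = |a + j|.  The positive part of a - t, formed in the unitization of
    A, vanishes modulo J since a + j <= t.  As J meets A trivially it vanishes
    altogether, which means a <= t. *)
Lemma rnorm_le_add_ideal_pos (a : T) (j : B) :
  cpos a -> J j -> cpos (csa_val a + j) -> rnorm a <= rnorm (csa_val a + j).
Proof.
move=> pa Jj paj; set t := rnorm (csa_val a + j).
have t0 : 0 <= t by exact: rnorm_ge0.
have upa : upos (uemb a) by exact: upos_uemb.
set x := uemb a - t%:C%:A.
have xs : selfadj x by apply: selfadjB; [exact: upos_selfadj|exact: selfadj_real].
have [s [ss se sc]] := abs_root_exists xs.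
have sx : GRing.comm s x by apply/commr_sym/sc.
have usx : uideal J (uincl s * (uincl s * uincl s + uincl x)).
  apply: (@pos_part_in_ideal _ _ (uideal J) _ _ (uemb j)).
  - exact: uideal_axioms.
  - by rewrite /selfadj -uincl_star ss.
  - by rewrite /selfadj -uincl_star xs.
  - by rewrite /GRing.comm -!uinclM sx.
  - by rewrite -!uinclM se.
  - by split.
  have -> : - (uincl x + uemb j) = t%:C%:A - uemb (csa_val a + j).
    by rewrite uinclB uinclZ uincl1 uincl_uemb addrAC -uembD opprB.
  by apply: upos_alg_sub; [exact/upos_selfadj/upos_uemb|rewrite nrm_uemb].
have sq0 : s * (s * s + x) = 0.
  move: usx; rewrite -uinclM -uinclD -uinclM; set w := s * _ => -[/= w2 Jw].
  apply: unitization_eq => //=; apply: csa_val_inj.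
  have : ((J : set B) `&` (A : set B)) (csa_val w.1) by split => //; exact: csa_valP.
  by rewrite JA0 => ->; have := csa_valZ 0 (0 : T); rewrite !scale0r.
rewrite -nrm_uemb; apply: (nrm_le_of_pos_part_eq0 upa ss t0).
exact: pos_part_eq0.
Qed.

(** This is the isometry of A -> B/J; it reduces to positive elements because
    adj (a + j) ** (a + j) and adj a ** a agree modulo J. *)
Lemma rnorm_le_add_ideal (a : T) (j : B) : J j -> rnorm a <= rnorm (csa_val a + j).
Proof.
move=> Jj; rewrite -(@ler_pXn2r _ 2)// ?nnegrE ?rnorm_ge0// -!rnorm_adj_mul.
set b := csa_val a + j.
have E : adj b ** b = csa_val (adj a ** a) + (adj (csa_val a) ** j + adj j ** b).
  by rewrite {1}/b adjD cmulDl {1}/b cmulDr csa_valM csa_val_adj addrA.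
(* the part added to adj a ** a is in J because adj j is *)
rewrite E; apply: rnorm_le_add_ideal_pos; first by exists a.
  apply: csubD; first exact: cid_mulr.
  by apply: cid_mull; exact: cid_adj.
by rewrite -E; exists b.
Qed.

End TrivialMeet.

(** The condition defining aperiodicity, for one element of B and with its norm
    in B; elements of different ideals can then be compared. *)
Definition kishimoto (x : B) := forall D : cstarSubalg T, hereditary D ->
  nonzero_subalg D -> forall eps : R, 0 < eps -> exists a : T,
  [/\ D a, cpos a, rnorm a = 1 & rnorm (csa_val a ** x ** csa_val a) < eps].

Lemma rnorm1P (a : T) : (`|a| = 1) <-> rnorm a = 1.
Proof.
split=> [h|h]; last by rewrite -rnormE h.
by apply: (@complexI R); rewrite rnormE h.
Qed.

Lemma aperiodic_ideal (J : closedIdeal B) :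
  aperiodic (ideal_bimod A J) <-> forall x, J x -> kishimoto x.
Proof.
split=> [h x Jx D hD nD eps e0|h x D hD nD eps e0].
  have [a [Da pa a1 ax]] := h (csub_in Jx) D hD nD eps e0.
  exists a; split => //; first exact/rnorm1P.
  move: ax; rewrite /= -norm_val val_ideal_ract val_ideal_lact val_csub_in.
  by rewrite -rnormE ltcR.
have [a [Da pa /rnorm1P a1 ax]] := h _ (csubP x) D hD nD eps e0.
exists a; split => //.
by rewrite /= -norm_val val_ideal_ract val_ideal_lact -rnormE ltcR.
Qed.

Lemma rnorm_conj_le (a : T) (x : B) : rnorm a = 1 ->
  rnorm (csa_val a ** x ** csa_val a) <= rnorm x.
Proof.
move=> a1; apply: le_trans (rnorm_cmul _ _) _.
rewrite (a1 : rnorm (csa_val a) = 1) mulr1; apply: le_trans (rnorm_cmul _ _) _.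
by rewrite (a1 : rnorm (csa_val a) = 1) mul1r.
Qed.

Lemma kishimoto0 : kishimoto 0.
Proof.
move=> D hD [d Dd d0] eps e0.
have nd : 0 < rnorm d.
  by rewrite lt_def rnorm_ge0 andbT; apply: contra_neq d0 => /rnorm_eq0.
pose c := (rnorm d)^-1%:C *: d.
have c1 : rnorm c = 1.
  by rewrite rnormZ -/(cabs _) cabs_real gtr0_norm ?invr_gt0// mulVf ?gt_eqF.
exists (adj c ** c); split.
- by apply: csa_mul; [apply: csa_adj|]; exact: csubZ.
- by exists c.
- by rewrite rnorm_adj_mul c1 expr1n.
- by rewrite cmul0 c0mul rnorm0.
Qed.

Lemma kishimotoZ (k : R[i]) x : kishimoto x -> kishimoto (k *: x).
Proof.
move=> kx D hD nD eps e0.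
have k0 : 0 < cabs k + 1 by apply: ltr_wpDl => //; exact: cabs_ge0.
have [a [Da pa a1 ax]] := kx D hD nD (eps / (cabs k + 1)) (divr_gt0 e0 k0).
exists a; split => //; rewrite -cscaleAr -cscaleAl rnormZ -/(cabs k).
move: ax; rewrite ltr_pdivlMr// mulrDr mulr1.
have := rnorm_ge0 (csa_val a ** x ** csa_val a); lra.
Qed.

(** Choose a for x in D, then d for y in a subalgebra of D on which a is a unit
    up to r.  Then d x d is within 2 r |x| of d a x a d. *)
Lemma kishimotoD x y : kishimoto x -> kishimoto y -> kishimoto (x + y).
Proof.
move=> kx ky D hD nD eps e0.
have e4 : 0 < eps / 4 by rewrite divr_gt0.
have [a [Da pa a1 ax]] := kx D hD nD _ e4.
have X0 := rnorm_ge0 x; have den : 0 < eps + 4 * rnorm x + 4 by lra.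
(* below 1, and small enough for 2 r |x| <= eps / 2 *)
pose r := eps / (eps + 4 * rnorm x + 4).
have r01 : 0 < r < 1 by rewrite divr_gt0//= ltr_pdivrMr// mul1r; lra.
have rx : 2 * (r * rnorm x) <= eps / 2.
  have rE : r * (eps + 4 * rnorm x + 4) = eps by rewrite divfK ?gt_eqF.
  by case/andP: r01 => r0 _; nra.
have [D1 [hD1 nD1 sD1 uD1]] := local_unit hD Da pa a1 r01.
have [d [Dd pd d1 dy]] := ky D1 hD1 nD1 _ e4.
have [dr dl] := uD1 d Dd; rewrite d1 mulr1 in dr dl.
exists d; split => //; first exact: sD1.
set v := csa_val d; set w := csa_val a; rewrite -/v -/w in ax dy.
have v1 : rnorm v = 1 by exact: d1.
have w1 : rnorm w = 1 by exact: a1.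
have E : v ** (x + y) ** v =
    v ** (w ** x ** w) ** v + (v - v ** w) ** x ** v
    + v ** w ** x ** (v - w ** v) + v ** y ** v.
  rewrite cmulDr cmulDl; congr (_ + _).
  rewrite 2!cmul_subl cmul_subr !cmulA.
  by rewrite -[RHS]addrA [X in _ = _ + X]addrA subrK subrKC.
have t1 : rnorm (v ** (w ** x ** w) ** v) < eps / 4.
  by apply: le_lt_trans ax; exact: rnorm_conj_le.
have t2 : rnorm ((v - v ** w) ** x ** v) <= r * rnorm x.
  apply: le_trans (rnorm_cmul _ _) _; rewrite v1 mulr1.
  by apply: le_trans (rnorm_cmul _ _) _; rewrite ler_wpM2r.
have t3 : rnorm (v ** w ** x ** (v - w ** v)) <= r * rnorm x.
  apply: le_trans (rnorm_cmul _ _) _; rewrite mulrC.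
  apply: ler_pM; rewrite ?rnorm_ge0//.
  apply: le_trans (rnorm_cmul _ _) _; rewrite ler_piMl//.
  by apply: le_trans (rnorm_cmul _ _) _; rewrite v1 w1 mulr1.
rewrite E; apply: le_lt_trans (rnormD _ _) _.
have := rnormD (v ** (w ** x ** w) ** v + (v - v ** w) ** x ** v)
  (v ** w ** x ** (v - w ** v)).
have := rnormD (v ** (w ** x ** w) ** v) ((v - v ** w) ** x ** v).
lra.
Qed.

Lemma kishimoto_approx x : (forall eps : R, 0 < eps ->
  exists2 y, kishimoto y & rnorm (x - y) < eps) -> kishimoto x.
Proof.
move=> h D hD nD eps e0; have e2 : 0 < eps / 2 by rewrite divr_gt0.
have [y ky xy] := h _ e2; have [a [Da pa a1 ay]] := ky D hD nD _ e2.
exists a; split => //; rewrite -(subrK y x) cmulDr cmulDl.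
apply: le_lt_trans (rnormD _ _) _; have := rnorm_conj_le (x - y) a1; lra.
Qed.

(** Multiplying by the unitization treats x, b x, x c and b x c at once. *)
Definition core_set (x : B) := forall u v : U, kishimoto (u * uemb x * v).1.

Lemma core0 : core_set 0.
Proof. by move=> u v; rewrite uemb0 mulr0 mul0r; exact: kishimoto0. Qed.

Lemma coreD x y : core_set x -> core_set y -> core_set (x + y).
Proof. by move=> hx hy u v; rewrite uembD mulrDr mulrDl uadd_1; exact: kishimotoD. Qed.

Lemma coreZ (k : R[i]) x : core_set x -> core_set (k *: x).
Proof.
by move=> hx u v; rewrite uembZ -scalerAr -scalerAl uscale_1; exact: kishimotoZ.
Qed.

Lemma core_closed : closed (core_set : set B).
Proof.
apply: closed_of_approx => x h u v; apply: kishimoto_approx => eps e0.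
have c0 : 0 < 2 * (nrm u * nrm v) + 1.
  by apply: ltr_wpDl => //; rewrite !mulr_ge0 ?nrm_ge0.
have [y hy xy] := h _ (divr_gt0 e0 c0).
exists (u * uemb y * v).1 => //.
have -> : (u * uemb x * v).1 - (u * uemb y * v).1 = (u * uemb (x - y) * v).1.
  by rewrite uembB mulrBr mulrBl.
apply: le_lt_trans (rnorm_fst_le _) _.
have h1 := nrmM (u * uemb (x - y)) v; have h2 := nrmM u (uemb (x - y)).
rewrite nrm_uemb in h2; move: xy; rewrite ltr_pdivlMr//.
have := ler_wpM2r (nrm_ge0 v) h2.
have := rnorm_ge0 (x - y); have := nrm_ge0 u; have := nrm_ge0 v; nra.
Qed.

Lemma core_mulr b x : core_set x -> core_set (b ** x).
Proof. by move=> hx u v; rewrite uembM mulrA. Qed.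

Lemma core_mull x b : core_set x -> core_set (x ** b).
Proof. by move=> hx u v; rewrite uembM mulrA -mulrA. Qed.

Definition aperiodic_core : closedIdeal B := @ClosedIdeal _ _
  (ClosedSubspace core0 coreD coreZ core_closed)
  core_mulr core_mull.

Lemma aperiodic_core_kishimoto x : aperiodic_core x -> kishimoto x.
Proof. by move=> /(_ 1 1); rewrite mulr1 mul1r. Qed.

Lemma sub_aperiodic_core (J : closedIdeal B) :
  (forall x, J x -> kishimoto x) -> (J : set B) `<=` (aperiodic_core : set B).
Proof. by move=> h x Jx u v; apply: h; exact: uideal_bimod. Qed.

Lemma full_subalg : exists2 D : cstarSubalg T, hereditary D & forall a, D a.
Proof.
have c : closed ((fun=> True) : set T) by exact: closedT.
pose S := @ClosedSubspace R T (fun=> True) I (fun _ _ _ _ => I) (fun _ _ _ => I) c.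
by exists (@CStarSubalg _ _ S (fun _ _ _ _ => I) (fun _ _ => I)).
Qed.

(** A nonzero element of J in A yields a positive a0 of norm one in J and A.  On
    a subalgebra where a0 is a unit up to 1/2, a norm-one d has
    |d a0 d| >= 1/2, against the smallness of a0. *)
Lemma trivial_meet_of_kishimoto (J : closedIdeal B) :
  (forall x, J x -> kishimoto x) -> trivial_meet A J.
Proof.
move=> kJ; apply/seteqP; split=> [x [Jx Ax]|_ ->]; last first.
  by split; exact: csub0.
apply: contrapT => x0.
pose b : T := csub_in Ax; have bx : csa_val b = x by exact: val_csub_in.
have nb : 0 < rnorm b.
  rewrite lt_def rnorm_ge0 andbT; apply/eqP => b0; apply: x0.
  by apply: rnorm_eq0; rewrite -bx.
pose c := (rnorm b)^-1%:C *: b.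
have c1 : rnorm c = 1.
  by rewrite rnormZ -/(cabs _) cabs_real gtr0_norm ?invr_gt0// mulVf ?gt_eqF.
pose a0 := adj c ** c; have pa0 : cpos a0 by exists c.
have n0 : rnorm a0 = 1 by rewrite rnorm_adj_mul c1 expr1n.
have [D hD allD] := full_subalg.
have r01 : 0 < (2^-1 : R) < 1 by lra.
have [D1 [hD1 nD1 _ uD1]] := local_unit hD (allD a0) pa0 n0 r01.
have ka0 : kishimoto (csa_val a0).
  apply: kJ; rewrite csa_valM; apply: cid_mulr.
  by rewrite csa_valZ bx; exact: csubZ.
have h2 : 0 < (2^-1 : R) by lra.
have [d [Dd pd d1 dd]] := ka0 D1 hD1 nD1 _ h2.
have [dr _] := uD1 d Dd; rewrite d1 mulr1 in dr.
have dd1 : rnorm (d ** d) = 1.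
  by rewrite -{1}(cpos_adj pd) rnorm_adj_mul d1 expr1n.
have e : d ** d = (d - d ** a0) ** d + d ** a0 ** d by rewrite cmul_subl subrK.
have := rnormD ((d - d ** a0) ** d) (d ** a0 ** d); rewrite -e dd1.
have := rnorm_cmul (d - d ** a0) d; rewrite d1 mulr1.
have : rnorm (d ** a0 ** d) < 2^-1 by move: dd; rewrite -!csa_valM.
lra.
Qed.

(** Let y = a x a lie within eps / 2 of A, say |y + b| < eps / 2 with b in A.
    As y is in J, |b| <= |y + b|, so |y| < eps. *)
Lemma kishimoto_of_trivial_meet (J : closedIdeal B) : aperiodic_inclusion A ->
  trivial_meet A J -> forall x, J x -> kishimoto x.
Proof.
move=> ap JA0 x Jx D hD nD eps e0; have e2 : 0 < eps / 2 by rewrite divr_gt0.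
have [a [Da pa /rnorm1P a1]] := ap (csub_pi A x) D hD nD _ e2.
rewrite /= quot_lact_pi quot_ract_pi norm_csub_quot ltcR.
set y := csa_val a ** x ** csa_val a => qy.
exists a; split => //; rewrite -/y.
have Jy : J y by apply: cid_mull; exact: cid_mulr.
have d0 : 0 < eps / 2 - quot_rnorm (csub_pi A y) by rewrite subr_gt0.
have [_ [z zy <-]] := inf_adherent d0 (quot_has_inf (csub_pi A y)).
rewrite -/(quot_rnorm _) subrKC => nz.
have Azy : A (z - y) by apply/csub_piP; exact: zy.
have := rnorm_le_add_ideal JA0 (csub_in Azy : T) Jy.
rewrite (val_csub_in Azy : csa_val (csub_in Azy) = _) subrK.
have := rnormB z (z - y); rewrite opprB subrKC.
rewrite (_ : rnorm (csub_in Azy : T) = rnorm (z - y)) => [|//].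
lra.
Qed.

End Inclusion.

Theorem theorem5p17 (R : realType) (B : cstarAlgType R) (A : cstarSubalg B) :
  aperiodic_inclusion A ->
  generalised_intersection_property A /\
  (forall N : closedIdeal B, hidden_ideal A N -> largest_aperiodic_ideal A N).
Proof.
move=> ap; set N := aperiodic_core A.
have N0 : trivial_meet A N.
  exact: trivial_meet_of_kishimoto (@aperiodic_core_kishimoto _ _ A).
have Nmax J : trivial_meet A J -> (J : set B) `<=` (N : set B).
  by move=> J0; apply: sub_aperiodic_core; exact: kishimoto_of_trivial_meet.
have maxN : maximal_trivial_meet A N by split => // J J0 _; exact: Nmax.
have uniqN J : maximal_trivial_meet A J -> N = J.
  move=> [J0 Jmax]; apply: closedIdeal_eq; apply/seteqP; split; last exact: Nmax.
  by apply: Jmax => //; exact: Nmax.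
split; first by exists N; split.
move=> _ [/uniqN <- _]; split.
  by apply/aperiodic_ideal => x; exact: aperiodic_core_kishimoto.
by move=> J /aperiodic_ideal; exact: sub_aperiodic_core.
Qed.
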